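(* Let $(\mathcal{M},g)$ be a closed surface, i.e. a compact connected oriented two-dimensional smooth Riemannian manifold without boundary, with area form $\mu$. Let $(\psi_0,\omega_0,\gamma_0,p_0)$ be any smooth (possibly time-dependent) solution, defined for $t\in[0,\infty)$, of the Euler equations on $\mathcal{M}$ in Hodge–Helmholtz form (given in the context). Then this flow is $L^2$-stable with respect to harmonic perturbations: for every $\epsilon>0$ there exists $\eta>0$ such that every smooth time-dependent harmonic covector field $\widetilde\gamma(t)$, $t\in[0,\infty)$, which for some smooth function $\widetilde p(t)$ satisfies the perturbation equation $$\widetilde\gamma_t+\omega_0\,\star\widetilde\gamma+d\widetilde p=0,\qquad t\ge 0,$$ and has $\|\widetilde\gamma(0)\|_{L^2}<\eta$, satisfies $\|\widetilde\gamma(t)\|_{L^2}<\epsilon$ for all $t\ge 0$.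
   Context: On the oriented Riemannian surface $(\mathcal{M},g)$ with area form $\mu$, let $\star$ be the Hodge star, with $\star f=f\mu$ and $\star\mu=1$ for functions $f$, and $\star\star\alpha=-\alpha$, $\alpha\wedge\star\beta=(\alpha,\beta)\mu$ for covector fields (1-forms) $\alpha,\beta$, where $(\cdot,\cdot)$ is the pointwise inner product induced by $g$. The codifferential is $\delta=-\star d\star$. The Hodge inner product of covector fields is $\langle\alpha,\beta\rangle=\int_{\mathcal{M}}(\alpha,\beta)\,\mu$, and $\|\alpha\|_{L^2}=\langle\alpha,\alpha\rangle^{1/2}$. A covector field $\gamma$ is harmonic if $d\gamma=0$ and $\delta\gamma=0$. A subscript $t$ denotes the time derivative. The incompressible Euler equations on $\mathcal{M}$ for a velocity field $v$ with dual covector field $v^\flat$, in rotational form, are $$v^\flat_t+\omega\,\star v^\flat+dp=F^\flat,\qquad \delta v^\flat=0,\qquad \omega=\star dv^\flat,$$ where $\omega$ is the vorticity function, $p=p_s+\tfrac12 v^\flat(v)$ is the Bernoulli pressure ($p_s$ being the static pressure), and $F$ is a given external force. By the Hodge decomposition, an incompressible covector field is written as $v^\flat=\star d\psi+\gamma$ with $\psi$ a stream function and $\gamma$ harmonic, which gives the Hodge–Helmholtz form $$\star d\psi_t+\gamma_t+\omega\,(-d\psi+\star\gamma)+dp=F^\flat,\qquad -\delta d\psi=\omega.$$ A harmonic perturbation of a solution $(\psi_0,\omega_0,\gamma_0,p_0)$ is a velocity perturbation of the form $\widetilde v^\flat=\widetilde\gamma$ with $\widetilde\gamma(t)$ a harmonic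 covector field for each $t$; its vorticity vanishes, so the perturbation equation, with $F$ unperturbed and $\widetilde p$ the Bernoulli pressure perturbation, is the one displayed in the claim. *)

(* Defs.v *)
From mathcomp Require Import all_boot all_order all_algebra.
From mathcomp Require Import all_classical all_reals all_analysis.
From mathcomp Require Import ring.

Set Implicit Arguments.
Unset Strict Implicit.
Unset Printing Implicit Defensive.

Import Order.TTheory GRing.Theory Num.Theory.
Import numFieldNormedType.Exports.

Local Open Scope classical_set_scope.
Local Open Scope ring_scope.

(* C^oo functions on a finite-dimensional normed space: every iterated
   directional derivative exists and is continuous on the open set U. *)
Definition smooth_open (R : realType) (E : normedModType R) (U : set E)
    (f : E -> R) : Prop :=
  forall (vs : seq E) (z : E), U z ->
    let h := foldr (fun v h => fun y => 'D_v h y) f vs in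
    {for z, continuous h} /\ forall v, derivable h z v.

(* Smoothness on an arbitrary subset: local extendability to smooth functions
   on open sets.  Used for open sets, where it is ordinary smoothness, and for
   [0, +oo[ times an open set. *)
Definition smooth_on (R : realType) (E : normedModType R) (A : set E)
    (f : E -> R) : Prop :=
  forall z, A z -> exists (V : set E) (G : E -> R),
    [/\ open V, V z, smooth_open V G & {in A `&` V, f =1 G}].

Definition coordinate (R : realType) (k : 'I_2) (u : R * R) : R :=
  if k == 0 then u.1 else u.2.

Definition unit_vector (R : realType) (k : 'I_2) : R * R :=
  if k == 0 then (1, 0) else (0, 1).

(* d(chi_i)/d(chi_j), read through chi_i \o xi_j, where xi_j inverts chi_j *)
Definition jacobian (R : realType) (M I : Type) (chi : I -> M -> R * R)
    (xi : I -> R * R -> M) (i j : I) (x : M) : 'M[R]_2 :=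
  \matrix_(k, l) 'D_(unit_vector R l) (fun u => coordinate k (chi i (xi j u))) (chi j x).

Record oriented_atlas (R : realType) (M : topologicalType) := OrientedAtlas {
  chart_index : Type;
  dom : chart_index -> set M;
  chart : chart_index -> M -> R * R;
  chart_inv : chart_index -> R * R -> M;
  dom_open : forall i, open (dom i);
  dom_cover : forall x, exists i, dom i x;
  cod_open : forall i, open (chart i @` dom i);
  chartK : forall i x, dom i x -> chart_inv i (chart i x) = x;
  chart_continuous : forall i, {within dom i, continuous (chart i)};
  chart_inv_continuous :
    forall i, {within chart i @` dom i, continuous (chart_inv i)};
  transition_smooth : forall i j k,
    smooth_on (chart j @` (dom i `&` dom j))
      (fun u => coordinate k (chart i (chart_inv j u)));
  transition_oriented : forall i j x, dom i x -> dom j x ->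
    0 < \det (jacobian chart chart_inv i j x) }.

Definition cod (R : realType) (M : topologicalType) (A : oriented_atlas R M)
    (i : chart_index A) : set (R * R) := chart i @` dom i.

Definition jac (R : realType) (M : topologicalType) (A : oriented_atlas R M)
    (i j : chart_index A) (x : M) : 'M[R]_2 :=
  jacobian (@chart R M A) (@chart_inv R M A) i j x.

(* Tensor fields are given by their components at x in the chart i; only the
   components with x in dom i are meaningful. *)
Record riemannian_metric (R : realType) (M : topologicalType)
    (A : oriented_atlas R M) := RiemannianMetric {
  gmx :> chart_index A -> M -> 'M[R]_2;
  gmx_sym : forall i x, dom i x -> (gmx i x)^T = gmx i x;
  gmx_pos : forall i x (v : 'cV[R]_2), dom i x -> v != 0 ->
    0 < (v^T *m gmx i x *m v) 0 0;
  gmx_jac : forall i j x, dom i x -> dom j x ->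
    gmx j x = (jac i j x)^T *m gmx i x *m jac i j x;
  gmx_smooth : forall i k l,
    smooth_on (cod i) (fun u => gmx i (chart_inv i u) k l) }.

Section tensors.
Variables (R : realType) (M : ptopologicalType) (A : oriented_atlas R M).

Definition form1 := chart_index A -> M -> 'rV[R]_2.

(* component with respect to dx /\ dy *)
Definition form2 := chart_index A -> M -> R.

Definition vfield := chart_index A -> M -> 'cV[R]_2.

Definition covector_law (a : form1) : Prop :=
  forall i j x, dom i x -> dom j x -> a j x = a i x *m jac i j x.

Definition vector_law (X : vfield) : Prop :=
  forall i j x, dom i x -> dom j x -> X i x = jac i j x *m X j x.

Definition halfline : set R := [set t | 0 <= t].

Definition smooth_function_t (f : R -> M -> R) : Prop :=
  forall i : chart_index A, smooth_on (halfline `*` cod i)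
    (fun z : R * (R * R) => f z.1 (chart_inv i z.2)).

Definition smooth_covector_field_t (a : R -> form1) : Prop :=
  (forall t, 0 <= t -> covector_law (a t)) /\
  forall (i : chart_index A) k, smooth_on (halfline `*` cod i)
    (fun z : R * (R * R) => a z.1 i (chart_inv i z.2) 0 k).

Definition smooth_vector_field_t (X : R -> vfield) : Prop :=
  (forall t, 0 <= t -> vector_law (X t)) /\
  forall (i : chart_index A) k, smooth_on (halfline `*` cod i)
    (fun z : R * (R * R) => X z.1 i (chart_inv i z.2) k 0).

(* derivative within [0, +oo[, hence one-sided at t = 0 *)
Definition dt (f : R -> R) (t : R) : R :=
  lim ((fun s => (f s - f t) / (s - t)) @ within halfline t^').

Definition function_t (f : R -> M -> R) (t : R) : M -> R :=
  fun x => dt (fun s => f s x) t.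

Definition form1_t (a : R -> form1) (t : R) : form1 :=
  fun i x => \row_k dt (fun s => a s i x 0 k) t.

Definition partial (i : chart_index A) (k : 'I_2) (f : M -> R) (x : M) : R :=
  'D_(unit_vector R k) (fun u => f (chart_inv i u)) (chart i x).

Definition d0 (f : M -> R) : form1 := fun i x => \row_k partial i k f x.

Definition d1 (a : form1) : form2 := fun i x =>
  partial i 0 (fun y => a i y 0 1) x - partial i 1 (fun y => a i y 0 0) x.

Definition wedge1 (a b : form1) : form2 := fun i x =>
  a i x 0 0 * b i x 0 1 - a i x 0 1 * b i x 0 0.

Variable g : riemannian_metric A.

Definition flat (X : vfield) : form1 := fun i x => (g i x *m X i x)^T.

Definition pairing (a b : form1) (i : chart_index A) (x : M) : R :=
  (a i x *m invmx (g i x) *m (b i x)^T) 0 0.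

Definition area_form : form2 := fun i x => Num.sqrt (\det (g i x)).

(* determined by star mu = 1; a function, whose value at x is read in any chart i
   around x *)
Definition star2 (b : form2) (i : chart_index A) (x : M) : R := b i x / area_form i x.

(* the solution b' = star b of a /\ b' = (a, b) mu for all a *)
Definition star1 (b : form1) : form1 := fun i x =>
  let s := b i x *m invmx (g i x) in
  area_form i x *: \row_k (if k == 0 then - s 0 1 else s 0 0).

Lemma wedge_star1 (a b : form1) i x : dom i x ->
  wedge1 a (star1 b) i x = pairing a b i x * area_form i x.
Proof.
move=> dx; rewrite /wedge1 /star1 /pairing !mxE /=.
have inv_sym k l : invmx (g i x) k l = invmx (g i x) l k.
  by rewrite -[in RHS](gmx_sym g dx) -trmx_inv mxE.
rewrite !big_ord_recl !big_ord0 !mxE !big_ord_recl !big_ord0 /=.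
have e0 : ord0 = 0 :> 'I_2 by [].
have e1 : lift ord0 ord0 = 1 :> 'I_2 by apply/val_inj.
rewrite ?e0 ?e1 (inv_sym 1 0).
by ring.
Qed.

Definition codiff (a : form1) (i : chart_index A) (x : M) : R :=
  - star2 (d1 (star1 a)) i x.

(* equality of tensor fields, chart by chart *)
Definition eq_field (T : Type) (a b : chart_index A -> M -> T) : Prop :=
  forall i x, dom i x -> a i x = b i x.

Definition harmonic (a : form1) : Prop :=
  [/\ covector_law a, eq_field (d1 a) (fun _ _ => 0)
    & eq_field (codiff a) (fun _ _ => 0)].

(* The Borel measure on M induced by the area form: in every chart it has
   density sqrt (det g) with respect to dx dy. *)
Definition is_area_measure
    (mu : {measure set (g_sigma_algebraType (@open M)) -> \bar R}) : Prop :=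
  forall (i : chart_index A) (B : set M), <<s @open M >> B -> B `<=` dom i ->
    mu B = (\int[(@lebesgue_measure R \x @lebesgue_measure R)%E]_(u in
        cod i `&` chart_inv i @^-1` B)
      (area_form i (chart_inv i u))%:E)%E.

(* Such a measure exists and is unique on a compact surface, so that the
   default value is irrelevant. *)
Definition area_measure :
    {measure set (g_sigma_algebraType (@open M)) -> \bar R} :=
  if pselect (exists mu, is_area_measure mu) is left h
  then projT1 (cid h) else mzero.

Definition chart_at (x : M) : chart_index A := projT1 (cid (dom_cover A x)).

Definition hodge_inner (a b : form1) : R :=
  \int[area_measure]_x pairing a b (chart_at x) x.

Definition L2norm (a : form1) : R := Num.sqrt (hodge_inner a a).

Definition euler_hodge_helmholtz (F : R -> vfield) (psi om : R -> M -> R)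
    (gam : R -> form1) (p : R -> M -> R) : Prop :=
  forall t, 0 <= t ->
    eq_field
      (fun i x => star1 (d0 (function_t psi t)) i x + form1_t gam t i x
         + om t x *: (- d0 (psi t) i x + star1 (gam t) i x) + d0 (p t) i x)
      (flat (F t))
    /\ eq_field (fun i x => - codiff (d0 (psi t)) i x) (fun _ x => om t x).

Definition perturbation_equation (om : R -> M -> R) (gam : R -> form1)
    (p : R -> M -> R) : Prop :=
  forall t, 0 <= t ->
    eq_field
      (fun i x => form1_t gam t i x + om t x *: star1 (gam t) i x
         + d0 (p t) i x)
      (fun _ _ => 0).

Definition smooth_harmonic_t (a : R -> form1) : Prop :=
  smooth_covector_field_t a /\ forall t, 0 <= t -> harmonic (a t).

End tensors.

(* Main.v *)
From HB Require Import structures.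
Require Import Defs.
From mathcomp Require Import all_boot all_order all_algebra.
From mathcomp Require Import all_classical all_reals all_analysis.
From mathcomp Require Import measurable_realfun ring lra.
Import Order.TTheory GRing.Theory Num.Theory.
Import numFieldNormedType.Exports.
Local Open Scope classical_set_scope.
Local Open Scope ring_scope.
Set Implicit Arguments.
Unset Strict Implicit.
Unset Printing Implicit Defensive.


(** Harmonic perturbations conserve their L^2 norm, so that eta = eps works.

    Write gamma for the perturbation and E(t) for its squared norm.  Pairing the
    perturbation equation with gamma gives
      (gamma_t, gamma) = - om (star gamma, gamma) - (dp, gamma),
    where the first term on the right vanishes pointwise because star is a
    rotation by a right angle ([pairing_star1_self]).  Hence
    E'(t) = 2 int (gamma_t, gamma) mu = - 2 int (dp, gamma) mu, and the last
    integral is 0 by the divergence theorem because gamma is coclosed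
    ([divergence_theorem]).  So E is constant ([energy_conserved]).

    The divergence theorem on the closed surface is proved with bump functions.
    Each point has a C^1 bump supported in a coordinate box ([exists_bump]);
    finitely many of them have a positive sum S, and f is the sum of the pieces
    beta_k f / S.  For a piece f supported in a box of a chart, with
    beta = star gamma,
      (df, gamma) mu = df /\ beta = d (f beta)
    ([pair_d0_divergence]), whose integral over the box is computed by Fubini and
    the fundamental theorem of calculus and vanishes because f does so on the
    boundary ([pair_d0_integral_box]).  The chart formula for integrals
    ([integral_chart]) is deduced from the chart formula for the measures of
    sets by approximation with simple functions ([ge0_integral_density]).

    Charts enter through covariance: the pairing of two covector fields can be
    computed in any chart ([pairing_chart]), and df is a covector field by the
    chain rule ([d0_covector]).  The chain rule requires Frechet
    differentiability, whereas smoothness is given by directional derivatives;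
    [partials_differentiable] bridges the two.

    Differentiation under the integral sign is applied to tau |-> E(tau^2),
    which is defined on the whole line ([smooth_time_sqr_derive]); the integrand
    is dominated because its tau-derivative is continuous on a compact product
    of the surface and a segment ([power_density_continuous]).

    If no area measure exists, all the norms are 0 by convention. *)

(** * Differentiability of functions on the plane *)

Lemma differentiable_from_estimate (R : realType) (V W : normedModType R)
    (f : V -> W) (x : V) (df : {linear V -> W}) :
  continuous df ->
  (forall e, 0 < e -> \forall h \near 0,
     `|f (h + x) - f x - df h| <= e * `|h|) ->
  differentiable f x /\ 'd f x = df :> (V -> W).
Proof.
move=> cdf est.
have E : f \o shift x = cst (f x) + df +o_ 0 id.
  apply/eqaddoP => e e0; near=> h => /=.
  rewrite -[X in `|X|]/(f (h + x) - (f x + df h)) opprD addrA.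
  by near: h; exact: est.
have dE := diff_unique cdf E; split => //.
by apply/diff_locallyP; rewrite dE; split.
Unshelve. all: by end_near. Qed.

Lemma diff_estimate (R : realType) (V W : normedModType R)
    (f : V -> W) (x : V) : differentiable f x ->
  (forall e, 0 < e -> \forall h \near 0,
     `|f (h + x) - f x - 'd f x h| <= e * `|h|).
Proof.
move=> /diff_locallyP[_ /eqaddoP fE] e e0.
have := fE e e0.
apply: filterS => h; rewrite -[X in `|X|]/(f (h + x) - (f x + 'd f x h)).
by rewrite opprD addrA.
Qed.

Lemma near_eq_differentiable (R : realType) (V W : normedModType R)
    (f g : V -> W) (x : V) : {near x, f =1 g} ->
  differentiable f x -> differentiable g x.
Proof.
move=> fg df; apply: (differentiable_from_estimate (df := 'd f x) _ _).1.
  exact: diff_continuous.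
move=> e e0; have := diff_estimate df e0.
have fg' : \forall h \near 0, f (h + x) = g (h + x).
  have := fg; rewrite (near_shift 0 x); apply: filterS => h /=.
  by rewrite subr0.
rewrite (nbhs_singleton fg).
by apply: filterS2 fg' => h /= ->.
Qed.

Section slices.
Variables (R : realType) (V1 V2 : normedModType R).
Implicit Types (f : V1 * V2 -> R) (u : V1 * V2).

Lemma is_derive_fst f u (v : V1) : derivable f u (v, 0) ->
  is_derive u.1 v (fun x => f (x, u.2)) ('D_(v, 0) f u).
Proof.
have E : (fun h : R => h^-1 *: (f (h *: (v, 0) + u) - f u)) =
  (fun h : R => h^-1 *: ((fun x => f (x, u.2)) (h *: v + u.1) - f (u.1, u.2))).
  apply/funext => h; rewrite [in LHS](surjective_pairing u).
  by congr (_ *: (f _ - _)); congr pair; rewrite /= scaler0 add0r.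
by rewrite /derivable /derive => du; apply: DeriveDef;
  rewrite /derivable /derive ?E // -E.
Qed.

Lemma is_derive_snd f u (v : V2) : derivable f u (0, v) ->
  is_derive u.2 v (fun y => f (u.1, y)) ('D_(0, v) f u).
Proof.
have E : (fun h : R => h^-1 *: (f (h *: (0, v) + u) - f u)) =
  (fun h : R => h^-1 *: ((fun y => f (u.1, y)) (h *: v + u.2) - f (u.1, u.2))).
  apply/funext => h; rewrite [in LHS](surjective_pairing u).
  by congr (_ *: (f _ - _)); congr pair; rewrite /= scaler0 add0r.
by rewrite /derivable /derive => du; apply: DeriveDef;
  rewrite /derivable /derive ?E // -E.
Qed.

End slices.

Section plane.
Variable R : realType.
Local Notation e_ := (unit_vector R).
Implicit Types (f g : R * R -> R) (u v : R * R).

Definition linR2 (a b : R) (h : R * R) : R := a * h.1 + b * h.2.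

Lemma linR2_linear a b : linear (linR2 a b).
Proof. by move=> k x y; rewrite /linR2 /=; rewrite /GRing.scale /=; ring. Qed.

HB.instance Definition _ a b :=
  GRing.isLinear.Build R (R * R)%type R _ (linR2 a b) (linR2_linear a b).

Lemma linR2_continuous a b : continuous (linR2 a b).
Proof.
move=> x; apply: cvgD; apply: cvgM; [exact: cvg_cst|exact: cvg_fst|exact: cvg_cst|exact: cvg_snd].
Qed.

(** The mean value theorem along a horizontal segment. *)
Lemma increment_fst f u (h : R) (e : R) (c : R) :
  (forall s, `|s| <= `|h| -> derivable f (s + u.1, u.2) (e_ 0)) ->
  (forall s, `|s| <= `|h| -> `|'D_(e_ 0) f (s + u.1, u.2) - c| <= e) ->
  `|f (h + u.1, u.2) - f u - c * h| <= e * `|h|.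
Proof.
move=> df De.
have key a b : a <= b -> (forall s, a <= s <= b -> `|s - u.1| <= `|h|) ->
   `|f (b, u.2) - f (a, u.2) - c * (b - a)| <= e * `|b - a|.
  move=> ab sub.
  have dd s : a <= s <= b ->
      is_derive s 1 (fun x => f (x, u.2)) ('D_(e_ 0) f (s, u.2)).
    move=> /sub sh; have := @is_derive_fst _ _ _ f (s, u.2); apply => /=.
    by rewrite -(subrK u.1 s); apply: df.
  have [x xab ->] : exists2 x, x \in `[a, b] &
      f (b, u.2) - f (a, u.2) = 'D_(e_ 0) f (x, u.2) * (b - a).
    apply: (@MVT_segment _ (fun x => f (x, u.2)) (fun x => 'D_(e_ 0) f (x, u.2))) => //.
      move=> x; rewrite in_itv /= => /andP[ax xb]; apply: dd.
      by rewrite !ltW.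
    apply: derivable_within_continuous => x; rewrite in_itv /= => xab.
    by case: (dd x xab).
  rewrite -mulrBl normrM ler_wpM2r //.
  have := De (x - u.1); rewrite subrK; apply; apply: sub.
  by move: xab; rewrite in_itv.
have [h0|h0] := leP 0 h.
  have := key u.1 (h + u.1); rewrite addrK -surjective_pairing; apply.
    by rewrite lerDr.
  by move=> s /andP[s1 s2]; rewrite (ger0_norm h0) ger0_norm; lra.
have := key (h + u.1) u.1; rewrite -surjective_pairing.
rewrite (_ : u.1 - (h + u.1) = - h); last by ring.
rewrite (_ : _ - c * - h = - (f (h + u.1, u.2) - f u - c * h)); last by ring.
rewrite !normrN; apply.
  by rewrite gerDr ltW.
by move=> s /andP[s1 s2]; rewrite (ltr0_norm h0) ler0_norm; lra.
Qed.

(** The increment of f is split along a horizontal and a vertical segment.  On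
    the vertical one, which starts at u, the derivative at u suffices; the
    horizontal one starts at a point that moves with the increment, and there the
    mean value theorem and the continuity of the partial derivative are used. *)
Lemma partials_differentiable f u :
  (\forall v \near u, derivable f v (e_ 0)) ->
  {for u, continuous (fun v => 'D_(e_ 0) f v)} ->
  derivable f u (e_ 1) -> differentiable f u.
Proof.
move=> df cD d1.
apply: (differentiable_from_estimate
  (df := linR2 ('D_(e_ 0) f u) ('D_(e_ 1) f u)) _ _).1.
  exact: linR2_continuous.
move=> e e0.
have e20 : 0 < e / 2 by rewrite divr_gt0.
have /cvgrPdist_le/(_ _ e20) cD' := cD.
have /nbhs_ballP[r /= r0 rH] : nbhs u [set v | derivable f v (e_ 0) /\
    `|'D_(e_ 0) f u - 'D_(e_ 0) f v| <= e / 2] by exact: filterI.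
have [ds1 <-] := is_derive_snd d1.
have /derivable1_diffP ds := ds1.
have := diff_estimate ds e20.
move=> [r' /= r'0 r'H].
apply/nbhs_ballP; exists (Num.min r r') => /=; first by rewrite lt_min r0.
move=> [h k] [] /=; rewrite /ball /= !sub0r !normrN !lt_min.
move=> /andP[hr hr'] /andP[kr kr'].
have hle : `|h| <= `|(h, k)| by rewrite prod_normE le_max lexx.
have kle : `|k| <= `|(h, k)| by rewrite prod_normE le_max lexx orbT.
rewrite /linR2 /=.
have near_u s : `|s| <= `|h| -> ball u r (s + u.1, k + u.2).
  move=> sh; split; rewrite /ball /= opprD addrCA subrr addr0 normrN //.
  exact: le_lt_trans hr.
have A1 : `|f (h + u.1, k + u.2) - f (u.1, k + u.2) - 'D_(e_ 0) f u * h| <= e / 2 * `|h|.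
  have := @increment_fst f (u.1, k + u.2) h (e / 2) ('D_(e_ 0) f u); apply => /=.
    by move=> s /near_u/rH[].
  by move=> s /near_u/rH[]; rewrite distrC.
have A2 : `|f (u.1, k + u.2) - f u - 'D_1 (fun y => f (u.1, y)) u.2 * k| <= e / 2 * `|k|.
  have := r'H k; rewrite /ball /= sub0r normrN => /(_ kr').
  rewrite -surjective_pairing -[in 'd _ _ _](mulr1 k) -[k * 1]/(k *: 1) linearZ /=.
  by rewrite -deriveE // mulrC [X in _ - X]mulrC.
rewrite (_ : (h, k) + u = (h + u.1, k + u.2)) //.
rewrite (_ : _ - _ = (f (h + u.1, k + u.2) - f (u.1, k + u.2) - 'D_(e_ 0) f u * h) +
  (f (u.1, k + u.2) - f u - 'D_1 (fun y : R => f (u.1, y)) u.2 * k)); last by ring.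
apply: (le_trans (ler_normD _ _)); rewrite [e in leRHS]splitr mulrDl.
by apply: lerD; [apply: (le_trans A1)|apply: (le_trans A2)]; rewrite ler_wpM2l // ltW.
Qed.
End plane.

(** * Functions of class C^1 near a point of the plane *)

Lemma continuous_pair_at (S T1 T2 : topologicalType) (h1 : S -> T1)
    (h2 : S -> T2) x : {for x, continuous h1} -> {for x, continuous h2} ->
  {for x, continuous (fun y => (h1 y, h2 y))}.
Proof.
move=> c1 c2.
exact: (@cvg_pair _ _ _ (nbhs x) (nbhs (h1 x)) (nbhs (h2 x)) _ _ _ h1 h2 c1 c2).
Qed.

Section C1.
Variable R : realType.
Local Notation e_ := (unit_vector R).
Implicit Types (f g : R * R -> R) (u v : R * R).

(** Differentiability is required on a neighborhood, so that the partial
    derivatives of sums, products and composites are given by the usual formulas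
    near u and not only at u. *)
Definition C1_at u f :=
  (\forall v \near u, differentiable f v) /\
  forall k, {for u, continuous (fun v => 'D_(e_ k) f v)}.

Lemma C1_at_differentiable u f : C1_at u f -> differentiable f u.
Proof. by case=> /nbhs_singleton. Qed.

Lemma C1_at_continuous u f : C1_at u f -> {for u, continuous f}.
Proof. by move=> /C1_at_differentiable; exact: differentiable_continuous. Qed.

Lemma C1_at_derivable u f v : C1_at u f -> derivable f u v.
Proof. by move=> /C1_at_differentiable; exact: diff_derivable. Qed.

Lemma near_eq_for_continuous (S T : topologicalType) (h1 h2 : S -> T) x :
  {near x, h1 =1 h2} -> {for x, continuous h1} -> {for x, continuous h2}.
Proof.
move=> h12 c1; rewrite /prop_for /continuous_at -(nbhs_singleton h12).
apply: cvg_trans c1; apply: near_eq_cvg; exact: h12.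
Qed.

Lemma C1_at_near_eq u f g : {near u, f =1 g} -> C1_at u f -> C1_at u g.
Proof.
move=> /near_join fg [df cf]; split.
  by apply: filterS2 fg df => v; exact: near_eq_differentiable.
move=> k; apply: near_eq_for_continuous (cf k).
by apply: filterS fg => v; exact: near_eq_derive.
Qed.

Lemma partials_C1_at u f :
  (\forall v \near u, forall k, derivable f v (e_ k) /\
     {for v, continuous (fun v => 'D_(e_ k) f v)}) -> C1_at u f.
Proof.
move=> H; split; last by move=> k; have [] := nbhs_singleton H k.
have := near_join H; apply: filterS => v Hv.
apply: partials_differentiable.
- by apply: filterS Hv => w /(_ 0)[].
- by have [] := nbhs_singleton Hv 0.
- by have [] := nbhs_singleton Hv 1.
Qed.

Lemma smooth_open_C1_at (U : set (R * R)) f u :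
  open U -> U u -> smooth_open U f -> C1_at u f.
Proof.
move=> oU Uu sf; apply: partials_C1_at.
near=> v => k; have Uv : U v by near: v; exact: open_nbhs_nbhs.
have [_ d] := sf [::] v Uv; have [c _] := sf [:: e_ k] v Uv.
by split.
Unshelve. all: by end_near. Qed.

Lemma smooth_on_C1_at (U : set (R * R)) f u :
  open U -> U u -> smooth_on U f -> C1_at u f.
Proof.
move=> oU Uu /(_ u Uu)[V [G [oV Vu sG fG]]].
apply: C1_at_near_eq (smooth_open_C1_at oV Vu sG).
near=> v; apply/esym/fG; rewrite inE; split; near: v.
  exact: open_nbhs_nbhs.
exact: open_nbhs_nbhs.
Unshelve. all: by end_near. Qed.

Lemma C1_at_cst u (c : R) : C1_at u (fun=> c).
Proof.
split; first by near=> v; exact: differentiable_cst.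
move=> k; apply: (near_cst_continuous 0); near=> v.
exact: (derive_cst c v (e_ k)).
Unshelve. all: by end_near. Qed.

Lemma C1_at_add u f g : C1_at u f -> C1_at u g -> C1_at u (fun v => f v + g v).
Proof.
move=> [df cf] [dg cg]; split.
  by apply: filterS2 df dg => v; exact: differentiableD.
move=> k; apply: near_eq_for_continuous; last first.
  by apply: continuousD; [exact: cf k|exact: cg k].
apply: filterS2 df dg => v dfv dgv; apply/esym/deriveD; exact: diff_derivable.
Qed.

Lemma C1_at_mul u f g : C1_at u f -> C1_at u g -> C1_at u (fun v => f v * g v).
Proof.
move=> Cf Cg; have [df cf] := Cf; have [dg cg] := Cg; split.
  by apply: filterS2 df dg => v; exact: differentiableM.
move=> k; apply: near_eq_for_continuous; last first.
  apply: continuousD; apply: continuousM.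
  - exact: C1_at_continuous Cf.
  - exact: cg k.
  - exact: C1_at_continuous Cg.
  - exact: cf k.
apply: filterS2 df dg => v dfv dgv; apply/esym.
by rewrite [LHS]deriveM; [|exact: diff_derivable|exact: diff_derivable].
Qed.

Lemma C1_at_opp u f : C1_at u f -> C1_at u (fun v => - f v).
Proof.
move=> Cf; have := C1_at_mul (C1_at_cst u (-1)) Cf.
by under eq_fun do rewrite mulN1r.
Qed.

Lemma C1_at_comp1 u f (phi dphi : R -> R) : C1_at u f ->
  (\forall y \near f u, is_derive (y : R) (1 : R) phi (dphi y)) ->
  {for f u, continuous dphi} -> C1_at u (fun v => phi (f v)).
Proof.
move=> Cf phiD cphi; have [df cf] := Cf.
have cfu := C1_at_continuous Cf.
have phiD' := cfu _ phiD; split.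
  apply: filterS2 df phiD' => v dfv [/derivable1_diffP + _].
  exact: differentiable_comp.
move=> k; apply: near_eq_for_continuous; last first.
  apply: continuousM; last exact: cf k.
  exact: (continuous_comp cfu cphi).
apply: filterS2 df phiD' => v dfv [/derivable1_diffP dp dE] /=.
apply/esym; rewrite [LHS]deriveE; last exact: differentiable_comp.
rewrite (diff_comp dfv dp) /= -(deriveE _ dfv).
rewrite -[in LHS](mulr1 ('D_(e_ k) f v)) -[_ * 1]/(_ *: 1) linearZ /=.
by rewrite -deriveE // dE mulrC.
Qed.

Lemma C1_at_inv u f : C1_at u f -> f u != 0 -> C1_at u (fun v => (f v)^-1).
Proof.
move=> Cf fu0; apply: (C1_at_comp1 (dphi := fun y => - y ^- 2)) Cf _ _.
  have : \forall y \near f u, y != 0 by exact: open_nbhs_nbhs.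
  apply: filterS => y y0; apply: DeriveDef; first exact: derivableV.
  by rewrite (deriveV (f := id)) // derive_id /GRing.scale /= mulr1.
apply: continuousN; apply: continuousV; first by rewrite expf_neq0.
exact: exprn_continuous.
Qed.

Lemma C1_at_sqrt u f : C1_at u f -> 0 < f u -> C1_at u (fun v => Num.sqrt (f v)).
Proof.
move=> Cf fu0; apply: (C1_at_comp1 (dphi := fun y => (2 * Num.sqrt y)^-1)) Cf _ _.
  have : \forall y \near f u, 0 < y by exact: lt_nbhsr.
  by apply: filterS => y y0; exact: is_derive1_sqrt.
apply: continuousV; first by rewrite mulf_neq0 // gt_eqF // sqrtr_gt0.
by apply: continuousM; [exact: cst_continuous|exact: sqrt_continuous].
Qed.

Lemma C1_at_linR2 u (a b : R) : C1_at u (linR2 a b).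
Proof.
have cL : continuous (linR2 a b) by exact: linR2_continuous.
split; first by near=> v; exact: linear_differentiable.
move=> k; apply: (near_cst_continuous (linR2 a b (e_ k))); near=> v.
by rewrite deriveE ?diff_lin //; exact: linear_differentiable.
Unshelve. all: by end_near. Qed.

Lemma C1_at_fst u : C1_at u fst.
Proof.
have -> : fst = linR2 1 0 :> (R * R -> R).
  by apply/funext => v; rewrite /linR2 mul1r mul0r addr0.
exact: C1_at_linR2.
Qed.

Lemma C1_at_snd u : C1_at u snd.
Proof.
have -> : snd = linR2 0 1 :> (R * R -> R).
  by apply/funext => v; rewrite /linR2 mul1r mul0r add0r.
exact: C1_at_linR2.
Qed.

(** The square makes the derivative 2 max(x, 0) continuous at the corner, so that
    bump functions built from this one are of class C^1. *)
Definition sqr_pos (x : R) := Num.max x 0 ^+ 2.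

(** The remainder of the first-order expansion is at most quadratic, with the same
    constant on both sides of the corner. *)
Lemma sqr_pos_expansion (x h : R) :
  `|sqr_pos (h + x) - sqr_pos x - 2 * Num.max x 0 * h| <= h ^+ 2.
Proof.
rewrite /sqr_pos ler_norml; case: (leP x 0) => x0; case: (leP (h + x) 0) => hx.
all: apply/andP; split; nra.
Qed.

Lemma is_derive_sqr_pos (x : R) : is_derive x 1 sqr_pos (2 * Num.max x 0).
Proof.
have [|e e0|dx dE] := @differentiable_from_estimate _ R R sqr_pos x
  (GRing.scale (2 * Num.max x 0)).
- exact: scaler_continuous.
- exists e => //= h; rewrite /ball /= sub0r normrN => he.
  apply: (le_trans (sqr_pos_expansion x h)).
  by rewrite -real_normK ?num_real // expr2 ler_wpM2r // ltW.
- apply: DeriveDef; first exact/derivable1_diffP.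
  by rewrite deriveE // dE; exact: mulr1.
Qed.

Lemma C1_at_sqr_pos u f : C1_at u f -> C1_at u (fun v => sqr_pos (f v)).
Proof.
move=> Cf; apply: (C1_at_comp1 (dphi := fun y => 2 * Num.max y 0)) Cf _ _.
  by near=> y; exact: is_derive_sqr_pos.
apply: continuousM; first exact: cst_continuous.
by apply: continuous_max; [exact: cvg_id|exact: cst_continuous].
Unshelve. all: by end_near. Qed.

Lemma diff_partials u f v : differentiable f u ->
  'd f u v = 'D_(e_ 0) f u * v.1 + 'D_(e_ 1) f u * v.2.
Proof.
move=> df; rewrite !deriveE // [v in LHS](_ : v = v.1 *: e_ 0 + v.2 *: e_ 1).
  by rewrite linearD !linearZ /= ![_ * v.1]mulrC ![_ * v.2]mulrC.
rewrite /unit_vector /= [LHS]surjective_pairing; congr pair => /=.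
  by rewrite /GRing.scale /= mulr1 mulr0 addr0.
by rewrite /GRing.scale /= mulr1 mulr0 add0r.
Qed.

Lemma derive_comp2 u f (T1 T2 : R * R -> R) w :
  differentiable T1 u -> differentiable T2 u -> differentiable f (T1 u, T2 u) ->
  'D_w (fun v => f (T1 v, T2 v)) u =
   'D_(e_ 0) f (T1 u, T2 u) * 'D_w T1 u + 'D_(e_ 1) f (T1 u, T2 u) * 'D_w T2 u.
Proof.
move=> d1 d2 df.
have dT := differentiable_pair d1 d2.
rewrite deriveE; last exact: (differentiable_comp dT df).
rewrite (diff_comp dT df) /= diff_partials // diff_pair //=.
by rewrite -!deriveE.
Qed.

Lemma C1_at_comp2 u f (T1 T2 : R * R -> R) :
  C1_at u T1 -> C1_at u T2 -> C1_at (T1 u, T2 u) f ->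
  C1_at u (fun v => f (T1 v, T2 v)).
Proof.
move=> C1 C2 Cf; have [d1 c1] := C1; have [d2 c2] := C2; have [df cf] := Cf.
have cT : {for u, continuous (fun v => (T1 v, T2 v))}.
  apply: (@differentiable_continuous _ _ _ u).
  by apply: differentiable_pair; exact: C1_at_differentiable.
have df' := cT _ df; split.
  near=> v; apply: (@differentiable_comp _ _ _ _ (fun v => (T1 v, T2 v))).
    by apply: differentiable_pair; near: v.
  by near: v.
move=> k; apply: near_eq_for_continuous; last first.
  apply: continuousD; apply: continuousM.
  - exact: (continuous_comp cT (cf 0)).
  - exact: c1 k.
  - exact: (continuous_comp cT (cf 1)).
  - exact: c2 k.
near=> v; apply/esym; apply: derive_comp2; near: v => //.
Unshelve. all: by end_near. Qed.
End C1.

(** * Functions that are smooth up to the initial time *)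

Section time.
Variable R : realType.
Local Notation e_ := (unit_vector R).

Lemma within_halfline_proper (t : R) : 0 <= t ->
  ProperFilter (within (@halfline R) t^').
Proof.
move=> t0; apply: Build_ProperFilter => -[e /= e0 H].
apply: (H (t + e / 2)) => /=.
- by rewrite opprD addNKr normrN gtr0_norm ?divr_gt0 // ltr_pdivrMr // mulr_natr mulr2n ltrDl.
- by rewrite -subr_eq0 addrC addKr gt_eqF // divr_gt0.
- by rewrite /halfline /= addr_ge0 // ltW // divr_gt0.
Qed.

Lemma dtE (h G : R -> R) (t : R) : 0 <= t -> derivable G t 1 ->
  (\forall s \near t, 0 <= s -> h s = G s) -> dt h t = 'D_1 G t.
Proof.
move=> t0 dG hG; rewrite /dt.
have PF := within_halfline_proper t0.
apply: cvg_lim => //.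
have ht : h t = G t by exact: (nbhs_singleton hG).
have dG' : (fun s => (G s - G t) / (s - t)) @ t^' --> 'D_1 G t.
  have := dG; rewrite /derivable /derive => /cvg_ex[l dl].
  move: (dl) => /cvg_lim -> //.
  apply/cvgrPdist_lt => e e0.
  have /cvgrPdist_lt/(_ e e0)[r /= r0 H] := dl.
  exists r => //= s; rewrite /ball /= distrC => sr st.
  have := H (s - t); rewrite /ball /= sub0r normrN subr_eq0 => /(_ sr st).
  by rewrite scaler1 subrK mulrC.
have dG2 := cvg_within_filter (@halfline R) dG'.
apply: (cvg_trans _ (dG2 _)).
apply: near_eq_cvg; rewrite /within /dnbhs /within /=.
apply: filterS hG => s H st s0 /=.
by rewrite ht H.
Qed.
End time.
Section time_dependent.
Variables (R : realType) (U : set (R * R)) (f : R * (R * R) -> R).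
Hypotheses (oU : open U) (sf : smooth_on (@halfline R `*` U) f).
Local Notation e_ := (unit_vector R).

Lemma smooth_time_C1_at (t : R) u : 0 <= t -> U u -> C1_at u (fun v => f (t, v)).
Proof.
move=> t0 Uu; have [//|V [G [oV Vtu sG fG]]] := sf (z := (t, u)).
have ct v : {for v, continuous (fun w : R * R => (t, w))}.
  by apply: continuous_pair_at; [exact: cst_continuous|exact: cvg_id].
have nV : \forall v \near u, V (t, v).
  by apply: (ct u); exact: open_nbhs_nbhs.
have CG : C1_at u (fun v => G (t, v)).
  apply: partials_C1_at; have := near_join nV; apply: filterS => v nVv k.
  have dG w : V (t, w) -> is_derive w (e_ k) (fun v => G (t, v)) ('D_(0, e_ k) G (t, w)).
    move=> Vw; have := @is_derive_snd _ _ _ G (t, w) (e_ k); apply.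
    by have [_] := sG [::] _ Vw; exact.
  split; first by case: (dG v (nbhs_singleton nVv)).
  apply: (@near_eq_for_continuous _ _ (fun w => 'D_(0, e_ k) G (t, w))).
    by apply: filterS nVv => w /dG[_ ->].
  have [cD _] := sG [:: (0, e_ k)] _ (nbhs_singleton nVv).
  exact: (continuous_comp (ct v) cD).
apply: C1_at_near_eq CG.
have nU : \forall v \near u, U v by exact: open_nbhs_nbhs.
by apply: filterS2 nU nV => v Uv Vv; apply/esym/fG; rewrite inE.
Qed.

Lemma smooth_time_dt (t : R) u (V : set (R * (R * R))) G : open V -> V (t, u) ->
  smooth_open V G -> {in (@halfline R `*` U) `&` V, f =1 G} ->
  0 <= t -> U u ->
  dt (fun s => f (s, u)) t = 'D_(1, 0) G (t, u) /\
  is_derive t 1 (fun s => G (s, u)) ('D_(1, 0) G (t, u)).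
Proof.
move=> oV Vtu sG fG t0 Uu.
have dG : is_derive t 1 (fun s => G (s, u)) ('D_(1, 0) G (t, u)).
  have := @is_derive_fst _ _ _ G (t, u) 1; apply.
  by have [_] := sG [::] _ Vtu; exact.
split=> //; case: (dG) => dG1 <-; apply: dtE => //.
have cu : {for t, continuous (fun s : R => (s, u))}.
  by apply: continuous_pair_at; [exact: cvg_id|exact: cst_continuous].
have nV : \forall s \near t, V (s, u) by apply: cu; exact: open_nbhs_nbhs.
by apply: filterS nV => s Vs s0; apply: fG; rewrite inE.
Qed.

(** Smoothness at time 0 is only one-sided.  Running time as the square of a
    parameter tau makes the function differentiable on the whole line: near
    tau = 0 only nonnegative times are visited. *)
Lemma smooth_time_sqr_derive (tau : R) u : U u ->
  is_derive tau 1 (fun s => f (s ^+ 2, u))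
    (2 * tau * dt (fun s => f (s, u)) (tau ^+ 2)).
Proof.
move=> Uu; have t0 := sqr_ge0 tau.
have [//|V [G [oV Vtu sG fG]]] := sf (z := (tau ^+ 2, u)).
have [-> dG] := smooth_time_dt oV Vtu sG fG t0 Uu.
have cu : {for tau, continuous (fun s : R => (s ^+ 2, u))}.
  by apply: continuous_pair_at; [exact: exprn_continuous|exact: cst_continuous].
have nV : \forall s \near tau, V (s ^+ 2, u) by apply: cu; exact: open_nbhs_nbhs.
have dsq : is_derive tau 1 (fun s : R => s ^+ 2) (2 * tau).
  by apply: is_derive_eq; rewrite /GRing.scale /=; ring.
have dc := @is_derive1_comp _ (fun s => G (s, u)) (fun s => s ^+ 2) _ _ _ dG dsq.
rewrite mulrC; apply: (near_eq_is_derive _ dc).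
apply: filterS nV => s Vs; apply/esym/fG; rewrite inE; split => //; split => //=.
exact: sqr_ge0.
Qed.

Lemma continuous_sqr_fst (T : topologicalType) (z : R * T) :
  {for z, continuous (fun z : R * T => (z.1 ^+ 2, z.2))}.
Proof.
apply: continuous_pair_at; last exact: cvg_snd.
exact: (continuous_comp cvg_fst (@exprn_continuous R 2 z.1)).
Qed.

Lemma smooth_time_sqr_continuous (tau : R) u : U u ->
  {for (tau, u), continuous (fun z : R * (R * R) => f (z.1 ^+ 2, z.2))}.
Proof.
move=> Uu; have [|V [G [oV Vtu sG fG]]] := sf (z := (tau ^+ 2, u)).
  by split=> //; exact: sqr_ge0.
have cs := @continuous_sqr_fst _ (tau, u).
apply: (@near_eq_for_continuous _ _ (fun z : R * (R * R) => G (z.1 ^+ 2, z.2))).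
  near=> z; apply/esym/fG; rewrite inE; split; last first.
    by near: z; apply: cs; exact: open_nbhs_nbhs.
  split; first exact: sqr_ge0.
  by near: z; apply: cvg_snd; exact: open_nbhs_nbhs.
have [cG _] := sG [::] _ Vtu.
exact: (continuous_comp cs cG).
Unshelve. all: by end_near. Qed.

Lemma smooth_time_sqr_partial_continuous (tau : R) u k : U u ->
  {for (tau, u), continuous (fun z : R * (R * R) =>
     'D_(e_ k) (fun v => f (z.1 ^+ 2, v)) z.2)}.
Proof.
move=> Uu; have [|V [G [oV Vtu sG fG]]] := sf (z := (tau ^+ 2, u)).
  by split=> //; exact: sqr_ge0.
have cs := @continuous_sqr_fst _ (tau, u).
apply: (@near_eq_for_continuous _ _
    (fun z : R * (R * R) => 'D_(0, e_ k) G (z.1 ^+ 2, z.2))).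
  have nV : \forall z \near (tau, u), V (z.1 ^+ 2, z.2).
    by apply: cs; exact: open_nbhs_nbhs.
  have nU : \forall z \near (tau, u), U z.2.
    by apply: cvg_snd; exact: open_nbhs_nbhs.
  apply: filterS2 nV nU => -[s v] /= Vz Uz.
  have [_ dG] := sG [::] _ Vz.
  have [_ <-] := @is_derive_snd _ _ _ G (s ^+ 2, v) (e_ k) (dG _).
  have cv : {for v, continuous (fun w : R * R => (s ^+ 2, w))}.
    by apply: continuous_pair_at; [exact: cst_continuous|exact: cvg_id].
  have nV : \forall w \near v, V (s ^+ 2, w) by apply: cv; exact: open_nbhs_nbhs.
  have nU : \forall w \near v, U w by exact: open_nbhs_nbhs.
  apply: near_eq_derive; apply: filterS2 nV nU => w Vw Uw.
  by apply/esym/fG; rewrite inE; split=> //; split=> //; exact: sqr_ge0.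
have [cG _] := sG [:: (0, e_ k)] _ Vtu.
exact: (continuous_comp cs cG).
Qed.
End time_dependent.

(** * Integration on coordinate boxes *)

Lemma open_setI_preimage_at (S T : topologicalType) (D : set S) (f : S -> T)
    (A : set T) : open D -> (forall x, D x -> {for x, continuous f}) -> open A ->
  open (D `&` f @^-1` A).
Proof.
move=> oD cf oA; rewrite openE => x [Dx Afx]; apply: filterI.
  exact: open_nbhs_nbhs.
by apply: (cf x Dx); exact: open_nbhs_nbhs.
Qed.

Lemma compact_bounded_at (R : realType) (S : topologicalType) (K : set S)
    (f : S -> R) : compact K -> (forall x, K x -> {for x, continuous f}) ->
  [bounded f x | x in K].
Proof.
move=> cK cf; have : compact (f @` K).
  by apply: continuous_compact cK; apply/continuous_in_subspaceT/in_setP.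
move=> /compact_bounded[M [Mr H]]; exists M; split=> // r Mr' x Kx.
by apply: (H r Mr'); exists x.
Qed.

Section plane_measure.
Variable R : realType.
Local Notation lambda2 := (@lebesgue_measure R \x @lebesgue_measure R)%E.
Local Notation e_ := (unit_vector R).

(** The Borel sets of the plane are generated by rectangles because an open set is
    a countable union of rectangles with rational endpoints. *)
Lemma open_measurable2 (U : set (R * R)) : open U ->
  measurable (U : set (measurableTypeR R * measurableTypeR R)).
Proof.
move=> oU.
pose I (p q : rat) : set R := `](ratr p), (ratr q)[%classic.
pose F (p q p' q' : rat) : set (R * R) :=
  if pselect (I p q `*` I p' q' `<=` U) then I p q `*` I p' q' else set0.
have -> : U = \bigcup_p \bigcup_q \bigcup_p' \bigcup_q' F p q p' q'.
  apply/seteqP; split=> [[x y] Uxy|z [p _ [q _ [p' _ [q' _]]]]]; last first.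
    by rewrite /F; case: pselect => // sub; exact: sub.
  have [[A B] /= [Ax By] AB] : nbhs (x, y) U by exact: open_nbhs_nbhs.
  have rat_nbhs (z : R) (C : set R) : nbhs z C -> exists p q, I p q z /\ I p q `<=` C.
    move=> /nbhs_ballP[e /= e0 eC].
    have /rat_in_itvoo[p pz] : z - e < z by rewrite ltrBlDr ltrDl.
    have /rat_in_itvoo[q qz] : z < z + e by rewrite ltrDl.
    move: pz qz; rewrite !in_itv /= => /andP[zp pz] /andP[zq qz].
    exists p, q; split; first by rewrite /I /= in_itv /= pz.
    move=> w; rewrite /I /= in_itv /= => /andP[pw wq]; apply: eC.
    by rewrite /ball /= ltr_distlC; apply/andP; split; lra.
  have [p [q [Ipq sA]]] := rat_nbhs _ _ Ax.
  have [p' [q' [Ipq' sB]]] := rat_nbhs _ _ By.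
  exists p => //; exists q => //; exists p' => //; exists q' => //.
  rewrite /F; case: pselect => // nsub; exfalso; apply: nsub.
  by move=> [s t] [/= /sA As /sB Bt]; exact: (AB (s, t)).
apply: bigcupT_measurable_rat => p; apply: bigcupT_measurable_rat => q.
apply: bigcupT_measurable_rat => p'; apply: bigcupT_measurable_rat => q'.
rewrite /F; case: (pselect (I p q `*` I p' q' `<=` U)) => sub /=; last exact: measurable0.
by apply: measurableX; exact: measurable_itv.
Qed.

Lemma preimage_measurable_fun d (X : measurableType d) (D : set X) (f : X -> R) :
  (forall A : set R, open A -> measurable (D `&` f @^-1` A)) ->
  measurable_fun D f.
Proof.
move=> H; apply: (measurability _ (measurable_realfun.RGenOpens.measurableE R)).
by move=> _ [_ [a [b ->] <-]]; apply: H; exact: interval_open.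
Qed.

Lemma measurable_fun_open2 (U : set (R * R)) (f : R * R -> R) : open U ->
  (forall u, U u -> {for u, continuous f}) ->
  measurable_fun (U : set (measurableTypeR R * measurableTypeR R)) f.
Proof.
move=> oU cf; apply: preimage_measurable_fun => A oA.
by apply: open_measurable2; exact: open_setI_preimage_at.
Qed.

Definition box (a b : R * R) : set (R * R) := `[a.1, b.1]%classic `*` `[a.2, b.2]%classic.

Lemma box_compact a b : compact (box a b).
Proof. by apply: compact_setX; exact: segment_compact. Qed.

Lemma box_measurable a b :
  measurable (box a b : set (measurableTypeR R * measurableTypeR R)).
Proof. by apply: measurableX; exact: measurable_itv. Qed.

Lemma box_finite a b : (lambda2 (box a b) < +oo)%E.
Proof.
rewrite product_measure1E; [|exact: measurable_itv|exact: measurable_itv].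
rewrite /= !lebesgue_measure_itv /=.
by do 2 case: ifP => _; rewrite -?EFinB ?mule0 ?mul0e // ltry.
Qed.

Lemma box_integrable a b (U : set (R * R)) (f : R * R -> R) : open U ->
  box a b `<=` U -> (forall u, U u -> {for u, continuous f}) ->
  lambda2.-integrable (box a b) (EFin \o f).
Proof.
move=> oU abU cf; apply: measurable_bounded_integrable.
- exact: box_measurable.
- exact: box_finite.
- apply: measurable_funS (measurable_fun_open2 oU cf) => //.
  exact: open_measurable2.
- by apply: compact_bounded_at; [exact: box_compact|move=> u /abU; exact: cf].
Qed.

Lemma integral_derive_segment (a b : R) (h dh : R -> R) : a < b ->
  (forall x, a <= x <= b -> is_derive x 1 h (dh x)) ->
  (forall x, a <= x <= b -> {for x, continuous dh}) ->
  (\int[@lebesgue_measure R]_(x in `[a, b]) (dh x)%:E = (h b - h a)%:E)%E.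
Proof.
move=> ab dhx cdh; rewrite EFinB; apply: continuous_FTC2 => //.
- apply/continuous_in_subspaceT/in_setP => x.
  by rewrite /= in_itv /=; exact: cdh.
- have ch x : a <= x <= b -> {for x, continuous h}.
    move=> /dhx[d _]; apply: differentiable_continuous; exact/derivable1_diffP.
  split.
  + move=> x; rewrite in_itv /= => /andP[ax xb].
    by case: (dhx x); rewrite ?(ltW ax) ?(ltW xb).
  + by apply: cvg_at_right_filter; apply: ch; rewrite lexx ltW.
  + by apply: cvg_at_left_filter; apply: ch; rewrite lexx ltW.
- move=> x; rewrite in_itv /= => /andP[ax xb].
  by rewrite derive1E; case: (dhx x); rewrite ?(ltW ax) ?(ltW xb).
Qed.

(** Fubini reduces the claim to horizontal segments, on which the integral of the
    derivative is the difference of the values at the endpoints. *)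
Lemma box_divergence_fst a b (U : set (R * R)) (W : R * R -> R) : open U ->
  a.1 < b.1 -> box a b `<=` U -> (forall u, U u -> C1_at u W) ->
  (forall y, a.2 <= y <= b.2 -> W (a.1, y) = 0 /\ W (b.1, y) = 0) ->
  (\int[lambda2]_(u in box a b) ('D_(e_ 0) W u)%:E = 0)%E.
Proof.
move=> oU ab abU CW W0.
have cD u : U u -> {for u, continuous (fun v => 'D_(e_ 0) W v)}.
  by move=> /CW[_]; exact.
have /integrable_mkcond iD := box_integrable oU abU cD.
rewrite integral_mkcond -integral21_prod_meas1; last exact: iD (box_measurable _ _).
rewrite /fubini_G; apply: integral0_eq => y _.
have [yab|nyab] := boolP (a.2 <= y <= b.2); last first.
  apply: integral0_eq => x _; rewrite patchE; case: ifPn => //.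
  by rewrite inE => -[_ /=]; rewrite in_itv /= (negbTE nyab).
transitivity (\int[@lebesgue_measure R]_(x in `[a.1, b.1]) ('D_(e_ 0) W (x, y))%:E)%E.
  rewrite [RHS]integral_mkcond; apply: eq_integral => x _; rewrite !patchE.
  rewrite (_ : ((x, y) \in box a b) = (x \in `[a.1, b.1]%classic)) //.
  apply/idP/idP; rewrite !inE /box /=; first by case.
  by move=> xab; split => //=; rewrite in_itv.
have sub x : a.1 <= x <= b.1 -> U (x, y).
  by move=> xab; apply: abU; split; rewrite /= in_itv.
have dW x : a.1 <= x <= b.1 ->
    is_derive x 1 (fun x => W (x, y)) ('D_(e_ 0) W (x, y)).
  move=> /sub/CW/C1_at_derivable => /(_ (e_ 0)).
  exact: (@is_derive_fst _ _ _ W (x, y) 1).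
have cW x : a.1 <= x <= b.1 -> {for x, continuous (fun x => 'D_(e_ 0) W (x, y))}.
  move=> /sub/cD c; have cx : {for x, continuous (fun x : R => (x, y))}.
    by apply: continuous_pair_at; [exact: cvg_id|exact: cst_continuous].
  exact: (continuous_comp cx c).
rewrite (integral_derive_segment ab dW cW).
by have [-> ->] := W0 y yab; rewrite subrr.
Qed.

Lemma box_divergence_snd a b (U : set (R * R)) (W : R * R -> R) : open U ->
  a.2 < b.2 -> box a b `<=` U -> (forall u, U u -> C1_at u W) ->
  (forall x, a.1 <= x <= b.1 -> W (x, a.2) = 0 /\ W (x, b.2) = 0) ->
  (\int[lambda2]_(u in box a b) ('D_(e_ 1) W u)%:E = 0)%E.
Proof.
move=> oU ab abU CW W0.
have cD u : U u -> {for u, continuous (fun v => 'D_(e_ 1) W v)}.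
  by move=> /CW[_]; exact.
have /integrable_mkcond iD := box_integrable oU abU cD.
rewrite integral_mkcond -integral12_prod_meas1; last exact: iD (box_measurable _ _).
rewrite /fubini_F; apply: integral0_eq => x _.
have [xab|nxab] := boolP (a.1 <= x <= b.1); last first.
  apply: integral0_eq => y _; rewrite patchE; case: ifPn => //.
  by rewrite inE => -[/= + _]; rewrite in_itv /= (negbTE nxab).
transitivity (\int[@lebesgue_measure R]_(y in `[a.2, b.2]) ('D_(e_ 1) W (x, y))%:E)%E.
  rewrite [RHS]integral_mkcond; apply: eq_integral => y _; rewrite !patchE.
  rewrite (_ : ((x, y) \in box a b) = (y \in `[a.2, b.2]%classic)) //.
  apply/idP/idP; rewrite !inE /box /=; first by case.
  by move=> yab; split => //=; rewrite in_itv.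
have sub y : a.2 <= y <= b.2 -> U (x, y).
  by move=> yab; apply: abU; split; rewrite /= in_itv.
have dW y : a.2 <= y <= b.2 ->
    is_derive y 1 (fun y => W (x, y)) ('D_(e_ 1) W (x, y)).
  move=> /sub/CW/C1_at_derivable => /(_ (e_ 1)).
  exact: (@is_derive_snd _ _ _ W (x, y) 1).
have cW y : a.2 <= y <= b.2 -> {for y, continuous (fun y => 'D_(e_ 1) W (x, y))}.
  move=> /sub/cD c; have cy : {for y, continuous (fun y : R => (x, y))}.
    by apply: continuous_pair_at; [exact: cst_continuous|exact: cvg_id].
  exact: (continuous_comp cy c).
rewrite (integral_derive_segment ab dW cW).
by have [-> ->] := W0 x xab; rewrite subrr.
Qed.
End plane_measure.

(** * Integrals with respect to a measure given by a density in a chart *)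

Section density.
Local Open Scope ereal_scope.
Import HBNNSimple.
Context d1 d2 (X : measurableType d1) (Y : measurableType d2) (R : realType).
Variables (lambda : {measure set X -> \bar R}) (mu : {measure set Y -> \bar R}).
Variables (D : set X) (phi : X -> Y) (w : X -> R) (E : set Y).
Hypotheses (mD : measurable D) (mphi : measurable_fun D phi)
  (mw : measurable_fun D w) (w0 : forall x, D x -> (0 <= w x)%R)
  (mE : measurable E).
Hypothesis muE : forall B, measurable B -> B `<=` E ->
  mu B = \int[lambda]_(x in D `&` phi @^-1` B) (w x)%:E.

Let DE := D `&` phi @^-1` E.
Let mDE : measurable DE. Proof. exact: mphi. Qed.
Let mwDE : measurable_fun DE w.
Proof. by apply: measurable_funS mw => // x []. Qed.
Let mphiDE : measurable_fun DE phi.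
Proof. by apply: measurable_funS mphi => // x []. Qed.

(** The hypothesis muE is the claim for indicator functions; it passes to simple
    functions by linearity and to f by monotone convergence. *)
Lemma ge0_integral_density (f : Y -> \bar R) :
  measurable_fun E f -> (forall y, E y -> 0 <= f y) ->
  \int[mu]_(y in E) f y = \int[lambda]_(x in DE) (f (phi x) * (w x)%:E).
Proof.
move=> mf f0; pose f_ := nnsfun_approx mE mf.
have mfphi n : measurable_fun DE (f_ n \o phi).
  exact: measurableT_comp mphiDE.
have w0' x : DE x -> 0 <= (w x)%:E by move=> [/w0]; rewrite lee_fin.
transitivity (limn (fun n => \int[mu]_(y in E) (f_ n y)%:E)).
  rewrite -monotone_convergence//.
  - apply: eq_integral => y /[!inE] yE; apply/esym/cvg_lim => //.
    by apply: cvg_nnsfun_approx.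
  - by move=> n; exact/measurable_EFinP/measurable_funTS.
  - by move=> n y _; rewrite lee_fin.
  - by move=> y _ m n mn; rewrite lee_fin; exact/lefP/nd_nnsfun_approx.
transitivity (limn (fun n => \int[lambda]_(x in DE) ((f_ n (phi x))%:E * (w x)%:E))); last first.
  rewrite -monotone_convergence//.
  - apply: eq_integral => x /[!inE] -[Dx Ex]; apply/cvg_lim => //.
    apply: cvgeZr => //; exact: (cvg_nnsfun_approx mE mf f0 Ex).
  - move=> n; apply: emeasurable_funM; first by apply/measurable_EFinP; exact: mfphi.
    exact/measurable_EFinP.
  - by move=> n x DEx; apply: mule_ge0; [rewrite lee_fin|exact: w0'].
  - move=> x DEx m n mn; rewrite lee_wpmul2r ?w0' // lee_fin.
    exact/lefP/nd_nnsfun_approx.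
congr (limn _); apply/funext => n.
transitivity (\sum_(k \in range (f_ n)) k%:E * mu (E `&` f_ n @^-1` [set k])).
  under eq_integral do rewrite fimfunE -fsumEFin//.
  rewrite ge0_integral_fsum//; last 2 first.
  - by move=> y; exact/measurable_EFinP/measurable_funM.
  - by move=> y x _; rewrite nnfun_muleindic_ge0.
  apply: eq_fsbigr => r _; rewrite integralZl_indic_nnsfun// integral_indic//=.
  by rewrite setIC.
transitivity (\sum_(k \in range (f_ n)) \int[lambda]_(x in DE)
    (k%:E * ((\1_(f_ n @^-1` [set k]) (phi x))%:E * (w x)%:E))).
  apply: eq_fsbigr => k; rewrite inE => -[y _ kE].
  have k0 : (0 <= k)%R by rewrite -kE.
  have mk : measurable (f_ n @^-1` [set k]) by exact: measurable_sfunP.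
  rewrite ge0_integralZl //.
  - rewrite muE; last 2 first.
    + exact: measurableI.
    + exact: subIsetl.
    congr (_ * _); rewrite preimage_setI setIA integral_mkcondr.
    apply: eq_integral => x _; rewrite patchE indicE.
    rewrite (_ : (x \in phi @^-1` _) = (phi x \in f_ n @^-1` [set k])); last first.
      by apply/idP/idP; rewrite !inE.
    by case: ifP; rewrite ?mul1e ?mul0e.
  - apply: emeasurable_funM; last exact/measurable_EFinP.
    apply/measurable_EFinP; apply: measurableT_comp mphiDE.
    exact: measurable_indic.
  - by move=> x DEx; apply: mule_ge0; [rewrite lee_fin|exact: w0'].
rewrite -ge0_integral_fsum//.
- apply: eq_integral => x _; rewrite [in RHS]fimfunE -fsumEFin//.
  rewrite ge0_mule_fsuml.
  + by apply: eq_fsbigr => k _; rewrite muleA EFinM.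
  + by move=> k; rewrite nnfun_muleindic_ge0.
- move=> k; apply: measurable_funeM; apply: emeasurable_funM; last exact/measurable_EFinP.
  apply/measurable_EFinP; apply: measurableT_comp mphiDE.
  by apply: measurable_indic; exact: measurable_sfunP.
- move=> k x DEx; rewrite muleA mule_ge0 ?w0' //.
  by rewrite -EFinM nnfun_muleindic_ge0.
Qed.

(** Positive and negative parts are transferred separately, which is possible
    because w is nonnegative. *)
Lemma integral_density (f : Y -> R) : measurable_fun E f ->
  \int[mu]_(y in E) (f y)%:E = \int[lambda]_(x in DE) (f (phi x) * w x)%:E.
Proof.
move=> mf; have mEf : measurable_fun E (EFin \o f) by exact/measurable_EFinP.
rewrite integralE [RHS]integralE; congr (_ - _).
- rewrite ge0_integral_density; last 2 first.
  + exact: measurable_funepos.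
  + by move=> y _; exact: funepos_ge0.
  apply: eq_integral => x; rewrite inE => -[Dx _].
  by rewrite !funeposE -!EFin_max -EFinM maxr_pMl ?mul0r ?w0.
- rewrite ge0_integral_density; last 2 first.
  + exact: measurable_funeneg.
  + by move=> y _; exact: funeneg_ge0.
  apply: eq_integral => x; rewrite inE => -[Dx _].
  by rewrite !funenegE -!EFinN -!EFin_max -EFinM maxr_pMl ?mul0r ?mulNr ?w0.
Qed.

End density.

(** * Matrices of size 2 *)

Lemma sum_ord2 (F : nmodType) (v : 'I_2 -> F) : \sum_k v k = v 0 + v 1.
Proof.
by rewrite !big_ord_recl big_ord0 addr0; congr (_ + v _); apply: val_inj.
Qed.

Lemma det2E (F : comNzRingType) (B : 'M[F]_2) :
  \det B = B 0 0 * B 1 1 - B 0 1 * B 1 0.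
Proof.
rewrite (expand_det_row _ 0) sum_ord2 /cofactor !det_mx11 !mxE /=.
rewrite expr0 expr1 mul1r mulN1r mulrN.
by congr (_ * B _ _ - _ * B _ _); apply: val_inj.
Qed.

Lemma ord2P (k : 'I_2) : k = 0 \/ k = 1.
Proof. by case: k => -[|[|//]] ?; [left|right]; apply: val_inj. Qed.

Lemma invmx2E (F : comUnitRingType) (B : 'M[F]_2) : B \in unitmx ->
  invmx B = (\det B)^-1 *:
    \matrix_(k, l) (if k == l then B (k + 1) (k + 1) else - B k l).
Proof.
move=> uB; have dB : \det B \is a GRing.unit by rewrite -unitmxE.
apply: (can_inj (mulKmx uB)); rewrite mulmxV // -scalemxAr.
have e2 : 1 + 1 = 0 :> 'I_2 by apply: val_inj.
have -> : 1%:M = (\det B)^-1 *: (\det B *: 1%:M) :> 'M[F]_(2, 2).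
  by rewrite scalerA mulVr // scale1r.
congr (_ *: _).
apply/matrixP => k l; rewrite !mxE sum_ord2 !mxE det2E.
by case: (ord2P k) => ->; case: (ord2P l) => ->; rewrite /= ?e2 ?add0r; ring.
Qed.

Section riemannian_matrix.
Variables (R : realType) (B : 'M[R]_2).
Hypotheses (Bsym : B^T = B)
  (Bpos : forall v : 'cV[R]_2, v != 0 -> 0 < (v^T *m B *m v) 0 0).

Lemma quad2E (v : 'cV[R]_2) : (v^T *m B *m v) 0 0 =
  B 0 0 * v 0 0 ^+ 2 + 2 * (B 0 1 * v 0 0 * v 1 0) + B 1 1 * v 1 0 ^+ 2.
Proof.
have B10 : B 1 0 = B 0 1 by rewrite -[in LHS]Bsym mxE.
by rewrite mxE sum_ord2 !mxE !sum_ord2 !mxE B10; ring.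
Qed.

(** Testing positivity on the first basis vector and on (- B01, B00) gives
    0 < B00 and 0 < B00 * det B. *)
Lemma pos_det2 : 0 < \det B.
Proof.
have B10 : B 1 0 = B 0 1 by rewrite -[in LHS]Bsym mxE.
have vec (x y : R) : (x != 0) || (y != 0) ->
    0 < B 0 0 * x ^+ 2 + 2 * (B 0 1 * x * y) + B 1 1 * y ^+ 2.
  move=> xy; pose v : 'cV[R]_2 := \col_k (if k == 0 then x else y).
  have := Bpos (v := v); rewrite quad2E !mxE /=; apply.
  apply: contraTneq xy => v0; have := congr1 (fun w : 'cV_2 => w 0 0) v0.
  have := congr1 (fun w : 'cV_2 => w 1 0) v0; rewrite !mxE /= => -> ->.
  by rewrite eqxx.
have B00 : 0 < B 0 0.
  by have := vec 1 0; rewrite oner_neq0 => /(_ isT); lra.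
have := vec (- B 0 1) (B 0 0); rewrite (gt_eqF B00) orbT => /(_ isT).
rewrite det2E B10 (_ : _ + _ + _ = B 0 0 * (B 0 0 * B 1 1 - B 0 1 * B 0 1)).
  by rewrite pmulr_rgt0.
by ring.
Qed.
End riemannian_matrix.

(** * Charts, C^1 functions and covector fields *)

Section manifold.
Variables (R : realType) (M : ptopologicalType) (A : oriented_atlas R M).
Local Notation e_ := (unit_vector R).
Implicit Types (i j : chart_index A) (x : M) (u : R * R).

Lemma cod_chart i x : dom i x -> cod i (chart i x).
Proof. by exists x. Qed.

Lemma dom_chart_inv i u : cod i u -> dom i (chart_inv i u).
Proof. by move=> [x dx <-]; rewrite chartK. Qed.

Lemma chart_invK i u : cod i u -> chart i (chart_inv i u) = u.
Proof. by move=> [x dx <-]; rewrite chartK. Qed.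

Lemma open_cod i : open (cod i). Proof. exact: (@cod_open _ _ A i). Qed.

Lemma chart_continuous_at i x : dom i x -> {for x, continuous (chart i)}.
Proof.
have := chart_continuous (o := A) (i := i).
rewrite (continuous_open_subspace _ (@dom_open _ _ A i)) => + dx; apply.
by rewrite inE.
Qed.

Lemma chart_inv_continuous_at i u : cod i u -> {for u, continuous (@chart_inv _ _ A i)}.
Proof.
have := chart_inv_continuous (o := A) (i := i).
rewrite (continuous_open_subspace _ (@cod_open _ _ A i)) => + du; apply.
by rewrite inE.
Qed.

Lemma near_cod i u : cod i u -> \forall v \near u, cod i v.
Proof. by move=> cu; apply: open_nbhs_nbhs; split=> //; exact: open_cod. Qed.

Lemma near_dom i x : dom i x -> \forall y \near x, dom i y.
Proof. by move=> dx; apply: open_nbhs_nbhs; split=> //; exact: dom_open. Qed.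

Definition C1_fun (f : M -> R) :=
  forall i u, cod i u -> C1_at u (fun v => f (chart_inv i v)).

Definition C1_form (a : form1 A) :=
  forall i k u, cod i u -> C1_at u (fun v => a i (chart_inv i v) 0 k).

Definition continuous_form (a : form1 A) :=
  forall i k u, cod i u -> {for u, continuous (fun v => a i (chart_inv i v) 0 k)}.

Lemma C1_form_continuous a : C1_form a -> continuous_form a.
Proof. by move=> Ca i k u cu; exact/C1_at_continuous/Ca. Qed.

Lemma transition_C1_at i j k x : dom i x -> dom j x ->
  C1_at (chart j x) (fun u => coordinate k (chart i (chart_inv j u))).
Proof.
move=> dix djx; pose U := cod j `&` chart_inv j @^-1` dom i.
apply: (@smooth_on_C1_at _ U).
- apply: open_setI_preimage_at; [exact: open_cod|exact: chart_inv_continuous_at|exact: dom_open].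
- by split; [exact: cod_chart|rewrite /= chartK].
- have := @transition_smooth _ _ A i j k; congr smooth_on.
  apply/seteqP; split=> [_ [y [diy djy] <-]|u [cu diu]].
    by split; [exact: cod_chart|rewrite /= chartK].
  by exists (chart_inv j u); [split=> //; exact: dom_chart_inv|exact: chart_invK].
Qed.

Lemma near_transition i j x : dom i x -> dom j x ->
  \forall u \near chart j x, cod j u /\ dom i (chart_inv j u).
Proof.
move=> dix djx; have cj := cod_chart djx; apply: filterI; first exact: near_cod.
apply: (chart_inv_continuous_at cj); rewrite chartK //; exact: near_dom.
Qed.

Lemma pair_coordinate (w : R * R) : (coordinate 0 w, coordinate 1 w) = w.
Proof. by rewrite /coordinate /= -surjective_pairing. Qed.

Lemma C1_fun_transition i j (f : R * R -> R) x : dom i x -> dom j x ->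
  C1_at (chart i x) f -> C1_at (chart j x) (fun u => f (chart i (chart_inv j u))).
Proof.
move=> dix djx Cf.
have := C1_at_comp2 (transition_C1_at 0 dix djx) (transition_C1_at 1 dix djx).
move=> /(_ f); rewrite chartK // pair_coordinate => /(_ Cf).
by congr (C1_at _ _); apply/funext => u; rewrite pair_coordinate.
Qed.

(** The chain rule for the change of charts. *)
Lemma d0_covector f : C1_fun f -> covector_law (d0 (A := A) f).
Proof.
move=> Cf i j x dix djx; apply/rowP => l; rewrite !mxE sum_ord2 !mxE /partial.
have D := derive_comp2 (e_ l) (C1_at_differentiable (transition_C1_at 0 dix djx))
  (C1_at_differentiable (transition_C1_at 1 dix djx)).
have := D (fun u => f (chart_inv i u)).
rewrite chartK // pair_coordinate => <-; last first.
  by apply: C1_at_differentiable; apply: Cf; exact: cod_chart.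
apply: near_eq_derive.
apply: filterS (near_transition dix djx) => u [cu diu].
by rewrite pair_coordinate chartK.
Qed.

End manifold.

(** * The pairing of covector fields *)

Section metric.
Variables (R : realType) (M : ptopologicalType) (A : oriented_atlas R M).
Variable g : riemannian_metric A.
Local Notation e_ := (unit_vector R).
Implicit Types (i j : chart_index A) (x : M) (u : R * R) (a b : form1 A).

Lemma det_gmx_gt0 i x : dom i x -> 0 < \det (g i x).
Proof.
by move=> dx; apply: pos_det2; [exact: gmx_sym|move=> v; exact: gmx_pos].
Qed.

Lemma gmx_unit i x : dom i x -> g i x \in unitmx.
Proof. by move=> dx; rewrite unitmxE unitfE gt_eqF // det_gmx_gt0. Qed.

Lemma jac_unit i j x : dom i x -> dom j x -> jac i j x \in unitmx.
Proof.
move=> dix djx; rewrite unitmxE unitfE gt_eqF //.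
exact: (transition_oriented dix djx).
Qed.

Lemma area_form_gt0 i x : dom i x -> 0 < area_form g i x.
Proof. by move=> dx; rewrite sqrtr_gt0 det_gmx_gt0. Qed.

(** The Jacobian J acts on covectors by a |-> a J and on the inverse metric by
    G^-1 |-> J^-1 G^-1 J^-T, so that the two actions cancel. *)
Lemma pairing_chart a b i j x : covector_law a -> covector_law b ->
  dom i x -> dom j x -> pairing g a b i x = pairing g a b j x.
Proof.
move=> la lb dix djx; rewrite /pairing (la i j x) // (lb i j x) //.
rewrite (gmx_jac g dix djx); set J := jac i j x; set G := g i x.
have uJ : J \in unitmx by exact: jac_unit.
have uG : G \in unitmx by exact: gmx_unit.
have uJT : J^T \in unitmx by rewrite unitmx_tr.
have uGJ : J^T *m G *m J \in unitmx by rewrite !unitmx_mul uJT uG uJ.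
have -> : invmx (J^T *m G *m J) = invmx J *m invmx G *m invmx J^T.
  rewrite -[RHS](mulmxK uGJ) [X in _ = X *m _](_ : _ = 1%:M) ?mul1mx //.
  by rewrite !mulmxA -(mulmxA _ (invmx J^T)) mulVmx // mulmx1 mulmxKV // mulVmx.
by rewrite trmx_mul !mulmxA mulmxK // mulmxKV.
Qed.

Definition pair a b x := pairing g a b (chart_at A x) x.

Lemma dom_chart_at x : dom (chart_at A x) x.
Proof. exact: projT2 (cid (dom_cover A x)). Qed.

Lemma pairE a b i x : covector_law a -> covector_law b -> dom i x ->
  pair a b x = pairing g a b i x.
Proof. by move=> la lb dx; apply: pairing_chart => //; exact: dom_chart_at. Qed.

Lemma pairing2E a b i x : pairing g a b i x =
  a i x 0 0 * b i x 0 0 * invmx (g i x) 0 0 +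
  a i x 0 0 * b i x 0 1 * invmx (g i x) 0 1 +
  a i x 0 1 * b i x 0 0 * invmx (g i x) 1 0 +
  a i x 0 1 * b i x 0 1 * invmx (g i x) 1 1.
Proof. by rewrite /pairing !mxE !sum_ord2 !mxE !sum_ord2; ring. Qed.

Lemma gmx_C1_at i k l u : cod i u ->
  C1_at u (fun v => g i (chart_inv i v) k l).
Proof.
move=> cu; apply: (smooth_on_C1_at (@open_cod _ _ A i) cu).
exact: gmx_smooth.
Qed.

Lemma det_gmx_C1_at i u : cod i u ->
  C1_at u (fun v => \det (g i (chart_inv i v))).
Proof.
move=> cu; under eq_fun do rewrite det2E.
apply: C1_at_add; first by apply: C1_at_mul; exact: gmx_C1_at.
by apply: C1_at_opp; apply: C1_at_mul; exact: gmx_C1_at.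
Qed.

Lemma area_form_C1_at i u : cod i u ->
  C1_at u (fun v => area_form g i (chart_inv i v)).
Proof.
move=> cu; apply: C1_at_sqrt; first exact: det_gmx_C1_at.
by apply: det_gmx_gt0; exact: dom_chart_inv.
Qed.

Lemma invmx_gmx_C1_at i k l u : cod i u ->
  C1_at u (fun v => invmx (g i (chart_inv i v)) k l).
Proof.
move=> cu.
apply: (@C1_at_near_eq _ _ (fun v => (\det (g i (chart_inv i v)))^-1 *
  (if k == l then g i (chart_inv i v) (k + 1) (k + 1) else - g i (chart_inv i v) k l))).
  apply: filterS (near_cod cu) => v cv.
  by rewrite invmx2E ?mxE ?gmx_unit //; exact: dom_chart_inv.
apply: C1_at_mul.
  apply: C1_at_inv; first exact: det_gmx_C1_at.
  by rewrite gt_eqF // det_gmx_gt0 //; exact: dom_chart_inv.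
by case: (k == l); [|apply: C1_at_opp]; exact: gmx_C1_at.
Qed.

Lemma star1_C1_form a : C1_form a -> C1_form (star1 g a).
Proof.
move=> Ca i k u cu.
have Cs l : C1_at u (fun v => (a i (chart_inv i v) *m invmx (g i (chart_inv i v))) 0 l).
  under eq_fun do rewrite mxE sum_ord2.
  by apply: C1_at_add; apply: C1_at_mul; [exact: Ca|exact: invmx_gmx_C1_at
    |exact: Ca|exact: invmx_gmx_C1_at].
under eq_fun do rewrite 2!mxE; apply: C1_at_mul; first exact: area_form_C1_at.
by case: (k == 0); [apply: C1_at_opp|]; exact: Cs.
Qed.

(** Joint continuity in a parameter and a point of the surface; the parameter is
    the square root of time when the energy is differentiated. *)
Lemma pair_continuous_param (T : topologicalType) (a b : T -> form1 A) :
  (forall t, covector_law (a t)) -> (forall t, covector_law (b t)) ->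
  (forall i k t u, cod i u -> {for (t, u), continuous (fun z : T * (R * R) =>
     a z.1 i (chart_inv i z.2) 0 k)}) ->
  (forall i k t u, cod i u -> {for (t, u), continuous (fun z : T * (R * R) =>
     b z.1 i (chart_inv i z.2) 0 k)}) ->
  continuous (fun z : T * M => pair (a z.1) (b z.1) z.2).
Proof.
move=> la lb ca cb [t x]; have dx := dom_chart_at x; set i := chart_at A x in dx.
pose h (z : T * (R * R)) := pairing g (a z.1) (b z.1) i (chart_inv i z.2).
have cx : {for (t, x), continuous (fun z : T * M => (z.1, chart i z.2))}.
  apply: continuous_pair_at; first exact: cvg_fst.
  have c2 : {for (t, x), continuous (fun z : T * M => z.2)} by exact: cvg_snd.
  exact: (continuous_comp c2 (chart_continuous_at dx)).
apply: (@near_eq_for_continuous _ _ (fun z : T * M => h (z.1, chart i z.2))).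
  have nd : \forall z \near (t, x), dom i z.2 by apply: cvg_snd; exact: near_dom.
  apply: filterS nd => -[s y] /= dy.
  by rewrite /h /= chartK // (pairE (i := i)).
have cu := cod_chart dx.
have ch : {for (t, chart i x), continuous h}.
  pose F k l (z : T * (R * R)) := a z.1 i (chart_inv i z.2) 0 k *
    b z.1 i (chart_inv i z.2) 0 l * invmx (g i (chart_inv i z.2)) k l.
  have -> : h = (fun z => F 0 0 z + F 0 1 z + F 1 0 z + F 1 1 z).
    by apply/funext => z; rewrite /h pairing2E.
  have cF k l : {for (t, chart i x), continuous (F k l)}.
    apply: continuousM; first by apply: continuousM; [exact: ca|exact: cb].
    have cG := C1_at_continuous (invmx_gmx_C1_at k l cu).
    have c2 : {for (t, chart i x), continuous (fun z : T * (R * R) => z.2)}.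
      exact: cvg_snd.
    exact: (continuous_comp c2 cG).
  by do 3 (apply: continuousD; last exact: cF); exact: cF.
exact: (continuous_comp cx ch).
Qed.

Lemma pair_continuous a b : covector_law a -> covector_law b ->
  continuous_form a -> continuous_form b -> continuous (pair a b).
Proof.
move=> la lb ca cb x.
have cx : {for x, continuous (fun y : M => (0 : R, y))}.
  by apply: continuous_pair_at; [exact: cst_continuous|exact: cvg_id].
have := @pair_continuous_param R (fun=> a) (fun=> b) (fun=> la) (fun=> lb).
move=> H; have {H} c : continuous (fun z : R * M => pair a b z.2).
  have c2 t u : {for (t, u), continuous (fun z : R * (R * R) => z.2)} by exact: cvg_snd.
  apply: H => i k t u cu; first exact: (continuous_comp (c2 t u) (ca i k u cu)).
  exact: (continuous_comp (c2 t u) (cb i k u cu)).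
exact: (continuous_comp cx (c (0, x))).
Qed.
End metric.

(** * Bump functions *)

Section C1_functions.
Variables (R : realType) (M : ptopologicalType) (A : oriented_atlas R M).
Local Notation e_ := (unit_vector R).
Implicit Types (i j : chart_index A) (x y : M) (u : R * R) (f h : M -> R).

Lemma C1_fun_cst c : C1_fun A (fun=> c).
Proof. by move=> i u _; exact: C1_at_cst. Qed.

Lemma C1_fun_add f h : C1_fun A f -> C1_fun A h -> C1_fun A (fun x => f x + h x).
Proof. by move=> Cf Ch i u cu; apply: C1_at_add; [exact: Cf|exact: Ch]. Qed.

Lemma C1_fun_mul f h : C1_fun A f -> C1_fun A h -> C1_fun A (fun x => f x * h x).
Proof. by move=> Cf Ch i u cu; apply: C1_at_mul; [exact: Cf|exact: Ch]. Qed.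

Lemma C1_fun_inv f : C1_fun A f -> (forall x, f x != 0) ->
  C1_fun A (fun x => (f x)^-1).
Proof. by move=> Cf f0 i u cu; apply: C1_at_inv => //; exact: Cf. Qed.

Lemma C1_fun_sum (I : Type) (s : seq I) (F : I -> M -> R) :
  (forall k, C1_fun A (F k)) -> C1_fun A (fun x => \sum_(k <- s) F k x).
Proof.
move=> CF; elim: s => [|k s IHs].
  by under eq_fun do rewrite big_nil; exact: C1_fun_cst.
by under eq_fun do rewrite big_cons; exact: (C1_fun_add (CF k) IHs).
Qed.

Lemma C1_fun_continuous f : C1_fun A f -> continuous f.
Proof.
move=> Cf x; have [i dx] := dom_cover A x.
apply: (@near_eq_for_continuous _ _ (fun y => f (chart_inv i (chart i y)))).
  by apply: filterS (near_dom dx) => y dy; rewrite chartK.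
have cf := C1_at_continuous (Cf i _ (cod_chart dx)).
exact: (continuous_comp (chart_continuous_at dx) cf).
Qed.

Definition open_box (a b u : R * R) := (a.1 < u.1 < b.1) && (a.2 < u.2 < b.2).

Lemma open_box_box a b u : open_box a b u -> box a b u.
Proof.
move=> /andP[/andP[u1 u2] /andP[u3 u4]].
by split; rewrite /= in_itv /= !ltW.
Qed.

Definition box_bump (a b u : R * R) : R :=
  sqr_pos ((u.1 - a.1) * (b.1 - u.1)) * sqr_pos ((u.2 - a.2) * (b.2 - u.2)).

Lemma sqr_pos_eq0 (r : R) : r <= 0 -> sqr_pos r = 0.
Proof. by move=> r0; rewrite /sqr_pos max_r // expr0n. Qed.

Lemma box_bump_ge0 a b u : 0 <= box_bump a b u.
Proof. by rewrite mulr_ge0 // sqr_ge0. Qed.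

Lemma box_bump_gt0 a b u : open_box a b u -> 0 < box_bump a b u.
Proof.
move=> /andP[/andP[u1 u2] /andP[u3 u4]].
by apply: mulr_gt0; rewrite exprn_gt0 // lt_max mulr_gt0 // subr_gt0.
Qed.

Lemma box_bump_neq0 a b u : a.1 < b.1 -> a.2 < b.2 -> box_bump a b u != 0 ->
  open_box a b u.
Proof.
move=> ab1 ab2; rewrite mulf_eq0 negb_or => /andP[n1 n2].
have pos (c d r : R) : c < d -> sqr_pos ((r - c) * (d - r)) != 0 -> c < r < d.
  move=> cd; apply: contra_neqT; rewrite negb_and -!leNgt => /orP[rc|dr].
    by apply: sqr_pos_eq0; rewrite mulr_le0_ge0 ?subr_le0 ?subr_ge0 // (le_trans rc (ltW cd)).
  by apply: sqr_pos_eq0; rewrite mulr_ge0_le0 ?subr_le0 ?subr_ge0 // (le_trans (ltW cd) dr).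
by apply/andP; split; exact: pos.
Qed.

Lemma box_bump_C1_at a b u : C1_at u (box_bump a b).
Proof.
have CB (T : R * R -> R) (c d : R) : C1_at u T ->
    C1_at u (fun v => sqr_pos ((T v - c) * (d - T v))).
  move=> CT; apply: C1_at_sqr_pos; apply: C1_at_mul.
    exact: (C1_at_add CT (C1_at_cst u (- c))).
  exact: (C1_at_add (C1_at_cst u d) (C1_at_opp CT)).
exact: (C1_at_mul (CB fst a.1 b.1 (C1_at_fst u)) (CB snd a.2 b.2 (C1_at_snd u))).
Qed.

Definition box_in_chart i a b := [/\ a.1 < b.1, a.2 < b.2 & box a b `<=` cod i].

Definition supported_in_box i a b (f : M -> R) :=
  forall y, f y != 0 -> dom i y /\ open_box a b (chart i y).

Lemma box_around i u : cod i u -> exists a b, box_in_chart i a b /\ open_box a b u.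
Proof.
move=> cu; have /nbhs_ballP[r /= r0 rU] := near_cod cu.
have r2 : 0 < r / 2 by rewrite divr_gt0.
exists (u.1 - r / 2, u.2 - r / 2), (u.1 + r / 2, u.2 + r / 2).
split; last by rewrite /open_box /=; apply/andP; split; lra.
split => /=; [lra|lra|].
move=> [v w] [/=]; rewrite !in_itv /= => /andP[v1 v2] /andP[w1 w2].
by apply: rU; split; rewrite /ball /= ltr_distlC; apply/andP; split; lra.
Qed.

Hypothesis M_hausdorff : hausdorff_space M.

Definition box_image i (a b : R * R) : set M := chart_inv i @` box a b.

Lemma box_image_closed i a b : box_in_chart i a b -> closed (box_image i a b).
Proof.
move=> [_ _ sub]; apply: compact_closed => //.
apply: continuous_compact; last exact: box_compact.
apply/continuous_in_subspaceT/in_setP => u /sub.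
exact: chart_inv_continuous_at.
Qed.

Lemma box_image_dom i a b : box_in_chart i a b -> box_image i a b `<=` dom i.
Proof. by move=> [_ _ sub] _ [u /sub cu <-]; exact: dom_chart_inv. Qed.

Lemma supported_in_box_out i a b f y : supported_in_box i a b f ->
  ~ box_image i a b y -> f y = 0.
Proof.
move=> sf ny; apply/eqP/negP => /negP /sf[dy oy]; apply: ny.
by exists (chart i y); [exact: open_box_box|rewrite chartK].
Qed.

Lemma near_box_image_out i a b y : box_in_chart i a b -> ~ box_image i a b y ->
  \forall z \near y, ~ box_image i a b z.
Proof.
move=> bc ny; have := closed_openC (box_image_closed bc).
by move=> oC; exact: (open_nbhs_nbhs (conj oC ny)).
Qed.

(** A bump of the chart is extended by 0.  The extension is C^1 because the image
    of the box is compact, hence closed in the Hausdorff surface: a point outside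
    the chart has a neighborhood on which the extension vanishes. *)
Lemma exists_bump x : exists (beta : M -> R) i a b,
  [/\ C1_fun A beta, forall y, 0 <= beta y, 0 < beta x, box_in_chart i a b
    & supported_in_box i a b beta].
Proof.
have [i dx] := dom_cover A x.
have [a [b [bc oxb]]] := box_around (cod_chart dx).
have [ab1 ab2 sub] := bc.
pose beta y := if `[< dom i y >] then box_bump a b (chart i y) else 0.
have betaE y : dom i y -> beta y = box_bump a b (chart i y).
  by move=> dy; rewrite /beta; case: asboolP.
have sbeta : supported_in_box i a b beta.
  move=> y; rewrite /beta; case: asboolP => [dy nz|_]; last by rewrite eqxx.
  by split=> //; exact: box_bump_neq0 nz.
exists beta, i, a, b; split=> //.
- move=> j u cu; have [diu|ndiu] := pselect (dom i (chart_inv j u)).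
    have dju := dom_chart_inv cu.
    have := C1_fun_transition diu dju (box_bump_C1_at a b _).
    rewrite chart_invK //; apply: C1_at_near_eq.
    have := near_transition diu dju; rewrite chart_invK //.
    by apply: filterS => v [_ div]; rewrite betaE.
  apply: C1_at_near_eq (C1_at_cst u 0).
  have nK : ~ box_image i a b (chart_inv j u).
    by move=> /(box_image_dom bc).
  have near_out : \forall v \near u, ~ box_image i a b (chart_inv j v).
    exact: (chart_inv_continuous_at cu (near_box_image_out bc nK)).
  by apply: filterS near_out => v nv; rewrite (supported_in_box_out sbeta).
- by move=> y; rewrite /beta; case: asboolP => // _; exact: box_bump_ge0.
- by rewrite betaE //; exact: box_bump_gt0.
Qed.

Lemma finite_bumps : compact [set: M] -> exists (beta : M -> M -> R) (s : seq M),
  [/\ forall x, C1_fun A (beta x), forall x y, 0 <= beta x y,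
    forall x, exists i a b, box_in_chart i a b /\ supported_in_box i a b (beta x)
    & forall y, exists2 x, x \in s & 0 < beta x y].
Proof.
move=> cM; have [beta betaP] := choice exists_bump.
have Cbeta x : C1_fun A (beta x) by have [i [a [b []]]] := betaP x.
have : cover_compact [set: M] by rewrite -compact_cover.
move=> /(_ M setT (fun x => [set y | 0 < beta x y])) [|y _|D _ Dcov].
- move=> x _; have := @open_comp _ _ (beta x) [set r | 0 < r].
  by apply; [move=> y _; exact: C1_fun_continuous|exact: open_gt].
- by exists y => //=; have [i [a [b []]]] := betaP y.
exists beta, (finmap.enum_fset D); split=> //.
- by move=> x y; have [i [a [b []]]] := betaP x.
- by move=> x; have [i [a [b []]]] := betaP x; exists i, a, b.
- by move=> y; have [x xD xy] := Dcov y I; exists x.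
Qed.

End C1_functions.

(** * The divergence theorem on a closed surface *)

Section stokes.
Variables (R : realType) (M : ptopologicalType).
Hypotheses (M_compact : compact [set: M]) (M_hausdorff : hausdorff_space M).
Variables (A : oriented_atlas R M) (g : riemannian_metric A).
Variable mu : {measure set (g_sigma_algebraType (@open M)) -> \bar R}.
Hypothesis mu_area : is_area_measure g mu.
Local Notation e_ := (unit_vector R).
Local Notation lambda2 := (@lebesgue_measure R \x @lebesgue_measure R)%E.
Local Notation borelM := (g_sigma_algebraType (@open M)).
Implicit Types (i j : chart_index A) (x y : M) (u : R * R) (f h : M -> R).

Lemma open_measurableM (U : set M) : open U -> measurable (U : set borelM).
Proof. exact: sub_sigma_algebra. Qed.

Lemma closed_measurableM (C : set M) : closed C -> measurable (C : set borelM).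
Proof.
move=> cC; rewrite -[C]setCK; apply: (@measurableC _ borelM).
by apply: open_measurableM; exact: closed_openC.
Qed.

Lemma continuous_measurableM f : continuous f ->
  measurable_fun [set: borelM] (f : borelM -> R).
Proof.
move=> cf; apply: preimage_measurable_fun => B oB; rewrite setTI.
by apply: open_measurableM; apply: open_comp => // x _; exact: cf.
Qed.

Lemma chart_inv_measurable i :
  measurable_fun (cod i : set (measurableTypeR R * measurableTypeR R))
    (@chart_inv _ _ A i : _ -> borelM).
Proof.
apply: (@measurability _ _ _ borelM _ _ (@open M)) => // _ [B oB <-].
apply: open_measurable2; apply: open_setI_preimage_at => //; first exact: open_cod.
by move=> u; exact: chart_inv_continuous_at.
Qed.

Lemma integral_chart i (K : set M) f : measurable (K : set borelM) ->
  K `<=` dom i -> measurable_fun (K : set borelM) f ->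
  (\int[mu]_(x in K) (f x)%:E = \int[lambda2]_(u in cod i `&` chart_inv i @^-1` K)
     (f (chart_inv i u) * area_form g i (chart_inv i u))%:E)%E.
Proof.
move=> mK Kdom mf.
have := @integral_density _ _ _ borelM R lambda2 mu (cod i) (@chart_inv _ _ A i)
  (fun u => area_form g i (chart_inv i u)) K; apply=> //.
- exact: (open_measurable2 (@open_cod _ _ A i)).
- exact: chart_inv_measurable.
- apply: measurable_fun_open2; first exact: open_cod.
  by move=> u cu; exact/C1_at_continuous/area_form_C1_at.
- by move=> u _; exact: sqrtr_ge0.
- by move=> B mB BK; apply: mu_area => // x /BK /Kdom.
Qed.

Lemma preimage_box_image i a b : box_in_chart i a b ->
  cod i `&` chart_inv i @^-1` box_image i a b = box a b.
Proof.
move=> [_ _ sub]; apply/seteqP; split=> [u [cu [v vb E]]|u ub].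
  by rewrite -(chart_invK cu) -E chart_invK //; exact: sub.
by split; [exact: sub|exists u].
Qed.

Lemma box_image_measurable i a b : box_in_chart i a b ->
  measurable (box_image i a b : set borelM).
Proof. by move=> bc; apply: closed_measurableM; exact: box_image_closed. Qed.

Lemma box_image_finite i a b : box_in_chart i a b -> (mu (box_image i a b) < +oo)%E.
Proof.
move=> bc; have [_ _ sub] := bc.
rewrite (mu_area (box_image_measurable bc) (box_image_dom bc)).
rewrite preimage_box_image //.
apply: integrable_lty; first exact: box_measurable.
apply: (box_integrable (@open_cod _ _ A i) sub) => u cu.
exact/C1_at_continuous/area_form_C1_at.
Qed.

(** The surface is covered by finitely many boxes, each of finite area. *)
Lemma area_finite : (mu setT < +oo)%E.
Proof.
have [beta [s [_ _ sup cov]]] := finite_bumps A M_hausdorff M_compact.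
suff [B [mB Bfin sB]] : exists B : set borelM, [/\ measurable B, (mu B < +oo)%E &
    forall x, x \in s -> [set y | beta x y != 0] `<=` B].
  apply: le_lt_trans Bfin; apply: le_measure; rewrite ?inE // => y _.
  by have [x /sB + xy] := cov y; apply; rewrite /= gt_eqF.
elim: (s) => [|x r [B [mB Bfin sB]]]; first by exists set0; rewrite measure0.
have [i [a [b [bc sx]]]] := sup x.
exists (B `|` box_image i a b); split.
- by apply: measurableU => //; exact: box_image_measurable.
- apply: le_lt_trans (measureU2 _ _ _) _ => //; first exact: box_image_measurable.
  by rewrite lte_add_pinfty // box_image_finite.
- move=> z; rewrite inE => /predU1P[->|zr] y /= nz; last by left; exact: (sB z).
  right; apply: contrapT => ny; move: nz.
  by rewrite (supported_in_box_out sx ny) eqxx.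
Qed.

Lemma continuous_integrableM f : continuous f ->
  mu.-integrable [set: borelM] (EFin \o f).
Proof.
move=> cf; apply: measurable_bounded_integrable => //.
- exact: area_finite.
- exact: continuous_measurableM.
- by apply: compact_bounded_at => // x _; exact: cf.
Qed.

Lemma d0_continuous_form f : C1_fun A f -> continuous_form (d0 (A := A) f).
Proof.
move=> Cf i k u cu; apply: (@near_eq_for_continuous _ _
  (fun v => 'D_(e_ k) (fun w => f (chart_inv i w)) v)).
  by apply: filterS (near_cod cu) => v cv; rewrite mxE /partial chart_invK.
by have [_] := Cf i u cu; exact.
Qed.

Variable gam : form1 A.
Hypotheses (gam_covector : covector_law gam) (gam_C1 : C1_form gam)
  (gam_coclosed : eq_field (codiff g gam) (fun _ _ => 0)).

Definition pair_d0 f x := pair g (d0 (A := A) f) gam x.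

Lemma pair_d0_continuous f : C1_fun A f -> continuous (pair_d0 f).
Proof.
move=> Cf; apply: pair_continuous => //.
- exact: d0_covector.
- exact: d0_continuous_form.
- exact: C1_form_continuous.
Qed.

Lemma pair_d0_integrable f : C1_fun A f ->
  mu.-integrable [set: borelM] (EFin \o pair_d0 f).
Proof. by move=> Cf; apply: continuous_integrableM; exact: pair_d0_continuous. Qed.

Let star i k u := star1 g gam i (chart_inv i u) 0 k.

Lemma star_closed i u : cod i u ->
  'D_(e_ 0) (star i 1) u = 'D_(e_ 1) (star i 0) u.
Proof.
move=> cu; have dx := dom_chart_inv cu.
have := gam_coclosed dx; rewrite /codiff /star2 => /eqP.
rewrite oppr_eq0 mulf_eq0 invr_eq0 (gt_eqF (area_form_gt0 g dx)) orbF.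
by rewrite /d1 /partial chart_invK // subr_eq0 => /eqP.
Qed.

(** With beta the Hodge dual of gamma, (df, gamma) mu = df /\ beta, and this is
    d (f beta) because beta is closed. *)
Lemma pair_d0_divergence f i u : C1_fun A f -> cod i u ->
  pair_d0 f (chart_inv i u) * area_form g i (chart_inv i u) =
  'D_(e_ 0) (fun v => f (chart_inv i v) * star i 1 v) u -
  'D_(e_ 1) (fun v => f (chart_inv i v) * star i 0 v) u.
Proof.
move=> Cf cu; have dx := dom_chart_inv cu.
rewrite /pair_d0 (pairE g (d0_covector Cf) gam_covector dx) -wedge_star1 //.
have dE k : d0 (A := A) f i (chart_inv i u) 0 k =
    'D_(e_ k) (fun v => f (chart_inv i v)) u by rewrite mxE /partial chart_invK.
rewrite /wedge1 !dE.
have df k : derivable (fun v => f (chart_inv i v)) u (e_ k).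
  by apply: C1_at_derivable; exact: Cf.
have ds k l : derivable (star i l) u (e_ k).
  by apply: C1_at_derivable; exact: star1_C1_form.
rewrite (deriveM (df 0) (ds 0 1)) (deriveM (df 1) (ds 1 0)) (star_closed cu).
by rewrite opprD addrACA subrr add0r; congr (_ - _); exact: mulrC.
Qed.

Lemma pair_d0_integral_box f i a b : C1_fun A f -> box_in_chart i a b ->
  supported_in_box i a b f -> (\int[mu]_x (pair_d0 f x)%:E = 0)%E.
Proof.
move=> Cf bc sf; have [ab1 ab2 sub] := bc.
have mK := box_image_measurable bc.
(* Outside the box f vanishes near every point, and so does df. *)
transitivity (\int[mu]_(x in box_image i a b) (pair_d0 f x)%:E)%E.
  rewrite [RHS]integral_mkcond; apply: eq_integral => x _; rewrite patchE.
  case: ifPn => //; rewrite notin_setE => nx; congr EFin.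
  have dx := dom_chart_at A x; set j := chart_at A x in dx.
  rewrite /pair_d0 (pairE g (d0_covector Cf) gam_covector dx) pairing2E.
  suff d00 k : d0 (A := A) f j x 0 k = 0 by rewrite !d00 !mul0r !addr0.
  rewrite mxE /partial -(derive_cst (0 : R) (chart j x) (e_ k)).
  apply: near_eq_derive.
  have near_out : \forall v \near chart j x, ~ box_image i a b (chart_inv j v).
    have nx' : ~ box_image i a b (chart_inv j (chart j x)) by rewrite chartK.
    exact: (chart_inv_continuous_at (cod_chart dx)
      (near_box_image_out M_hausdorff bc nx')).
  by apply: filterS near_out => v nv; rewrite (supported_in_box_out sf).
rewrite (integral_chart mK (box_image_dom bc)); last first.
  by apply: measurable_funTS; apply: continuous_measurableM; exact: pair_d0_continuous.
rewrite preimage_box_image //.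
pose W k v := f (chart_inv i v) * star i k v.
have CW k u : cod i u -> C1_at u (W k).
  by move=> cu; apply: C1_at_mul; [exact: Cf|exact: star1_C1_form].
have W0 k u : cod i u -> ~~ open_box a b u -> W k u = 0.
  move=> cu no; rewrite /W; have [-> //|/eqP nz] := pselect (f (chart_inv i u) = 0).
    by rewrite mul0r.
  by have [_] := sf _ nz; rewrite chart_invK // (negbTE no).
have iD k l : lambda2.-integrable (box a b) (EFin \o (fun u => 'D_(e_ l) (W k) u)).
  apply: (box_integrable (@open_cod _ _ A i) sub) => u cu.
  by have [_] := CW k u cu; exact.
transitivity (\int[lambda2]_(u in box a b)
   (('D_(e_ 0) (W 1) u)%:E - ('D_(e_ 1) (W 0) u)%:E))%E.
  apply: eq_integral => u; rewrite inE => /sub cu.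
  by rewrite pair_d0_divergence.
rewrite integralB //; [|exact: box_measurable|exact: iD|exact: iD].
rewrite (box_divergence_fst (@open_cod _ _ A i) ab1 sub (CW 1)); last first.
  move=> y yab; split; apply: W0.
  - by apply: sub; split; rewrite /= in_itv //= lexx ltW.
  - by rewrite /open_box /= ltxx.
  - by apply: sub; split; rewrite /= in_itv //= lexx ltW.
  - by rewrite /open_box /= ltxx andbF.
rewrite (box_divergence_snd (@open_cod _ _ A i) ab2 sub (CW 0)); last first.
  move=> y yab; split; apply: W0.
  - by apply: sub; split; rewrite /= in_itv //= lexx ltW.
  - by rewrite /open_box /= ltxx andbF.
  - by apply: sub; split; rewrite /= in_itv //= lexx ltW.
  - by rewrite /open_box /= ltxx !andbF.
by rewrite sube0.
Qed.

Lemma pair_d0_add f h x : C1_fun A f -> C1_fun A h ->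
  pair_d0 (fun y => f y + h y) x = pair_d0 f x + pair_d0 h x.
Proof.
move=> Cf Ch; have dx := dom_chart_at A x.
rewrite /pair_d0 /pair; set i := chart_at A x in dx *.
have dD k : d0 (A := A) (fun y => f y + h y) i x 0 k =
    d0 (A := A) f i x 0 k + d0 (A := A) h i x 0 k.
  rewrite !mxE /partial [LHS]deriveD //; apply: C1_at_derivable.
    exact/Cf/cod_chart.
  exact/Ch/cod_chart.
by rewrite !pairing2E !dD; ring.
Qed.

(** Partition of unity: with S the sum of finitely many bumps covering the
    surface, f is the sum of the functions beta_k f / S, each of them supported in
    a coordinate box. *)
Theorem divergence_theorem f : C1_fun A f -> (\int[mu]_x (pair_d0 f x)%:E = 0)%E.
Proof.
move=> Cf; have [beta [s [Cb b0 sup cov]]] := finite_bumps A M_hausdorff M_compact.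
pose S y := \sum_(x <- s) beta x y.
have CS : C1_fun A S by exact: C1_fun_sum.
have S0 y : S y != 0.
  have [x xs xy] := cov y; rewrite gt_eqF // /S (big_rem x) //=.
  by rewrite ltr_pwDl // sumr_ge0.
pose q y := f y * (S y)^-1.
have Cq : C1_fun A q := C1_fun_mul Cf (C1_fun_inv CS S0).
have -> : f = (fun y => \sum_(x <- s) beta x y * q y).
  by apply/funext => y; rewrite -mulr_suml -/(S y) /q mulrCA mulfV ?mulr1.
have Cbq x : C1_fun A (fun y => beta x y * q y) := C1_fun_mul (Cb x) Cq.
elim: (s) => [|x r IHr].
  rewrite (_ : (fun y => _) = fun=> 0); last by apply/funext => y; rewrite big_nil.
  apply: integral0_eq => x _; rewrite /pair_d0 /pair pairing2E.
  have d00 k : d0 (A := A) (fun=> 0) (chart_at A x) x 0 k = 0.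
    by rewrite mxE; exact: (derive_cst (0 : R) (chart (chart_at A x) x) (e_ k)).
  by rewrite !d00 !mul0r !addr0.
rewrite (_ : (fun y => _) =
  fun y => beta x y * q y + \sum_(z <- r) beta z y * q y); last first.
  by apply/funext => y; rewrite big_cons.
pose f1 y := beta x y * q y; pose f2 y := \sum_(z <- r) beta z y * q y.
have C1 : C1_fun A f1 := Cbq x.
have C2 : C1_fun A f2 := C1_fun_sum r Cbq.
transitivity (\int[mu]_y ((pair_d0 f1 y)%:E + (pair_d0 f2 y)%:E))%E.
  by apply: eq_integral => y _; rewrite (pair_d0_add y C1 C2) EFinD.
rewrite (integralD measurableT (pair_d0_integrable C1) (pair_d0_integrable C2)).
rewrite IHr adde0; have [i [a [b [bc sx]]]] := sup x.
apply: (pair_d0_integral_box (Cbq x) bc) => y; rewrite mulf_eq0 negb_or => /andP[+ _].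
exact: sx.
Qed.

End stokes.

(** * Conservation of the energy of a harmonic perturbation *)

Section energy.
Variables (R : realType) (M : ptopologicalType).
Hypotheses (M_compact : compact [set: M]) (M_hausdorff : hausdorff_space M).
Variables (A : oriented_atlas R M) (g : riemannian_metric A).
Variables (om p : R -> M -> R) (gam : R -> form1 A).
Hypotheses (gam_harmonic : smooth_harmonic_t g gam)
  (p_smooth : smooth_function_t A p)
  (gam_p : perturbation_equation g om gam p).
Local Notation e_ := (unit_vector R).
Implicit Types (i : chart_index A) (x : M) (t tau : R).

(** By definition of the Hodge star, (star b, b) mu = star b /\ star b. *)
Lemma pairing_star1_self (b : form1 A) i x : dom i x ->
  pairing g (star1 g b) b i x = 0.
Proof.
move=> dx; have := wedge_star1 g (star1 g b) b dx.
rewrite /wedge1 mulrC subrr => /esym/eqP.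
by rewrite mulf_eq0 (gt_eqF (area_form_gt0 g dx)) orbF => /eqP.
Qed.

Lemma pairing_linear (a b c d : form1 A) (r : R) i x :
  (forall k, a i x 0 k = - (r * b i x 0 k) - c i x 0 k) ->
  pairing g a d i x = - (r * pairing g b d i x) - pairing g c d i x.
Proof. by move=> E; rewrite !pairing2E !E; ring. Qed.

Lemma pairing_form1_t t i x : 0 <= t -> dom i x ->
  pairing g (form1_t gam t) (gam t) i x =
  - pairing g (d0 (A := A) (p t)) (gam t) i x.
Proof.
move=> t0 dx; have eqn := gam_p t0 dx.
have E k : form1_t gam t i x 0 k =
    - (om t x * star1 g (gam t) i x 0 k) - d0 (A := A) (p t) i x 0 k.
  have := congr1 (fun v : 'rV_2 => v 0 k) eqn.
  rewrite /= [_ 0 k]mxE [X in X + _]mxE [X in _ + X + _]mxE [RHS]mxE => H.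
  by lra.
by rewrite (pairing_linear _ E) pairing_star1_self // mulr0 oppr0 add0r.
Qed.

Lemma gam_covector t : 0 <= t -> covector_law (gam t).
Proof. by move=> t0; have [[+ _] _] := gam_harmonic; apply. Qed.

Lemma gam_C1 t : 0 <= t -> C1_form (gam t).
Proof.
move=> t0 i k u cu; have [[_ sm] _] := gam_harmonic.
exact: (smooth_time_C1_at (@open_cod _ _ A i) (sm i k) t0 cu).
Qed.

Lemma p_C1 t : 0 <= t -> C1_fun A (p t).
Proof.
move=> t0 i u cu.
have sm := p_smooth (i := i).
exact: (smooth_time_C1_at (@open_cod _ _ A i) sm t0 cu).
Qed.

Definition energy_density tau x := pair g (gam (tau ^+ 2)) (gam (tau ^+ 2)) x.

Definition power_density tau x :=
  - 4 * tau * pair_d0 g (gam (tau ^+ 2)) (p (tau ^+ 2)) x.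

Lemma is_derive_quadratic (c0 c1 : R -> R) (c0' c1' G00 G01 G11 tau : R) :
  is_derive tau 1 c0 c0' -> is_derive tau 1 c1 c1' ->
  is_derive tau 1
    (fun s => c0 s * c0 s * G00 + c0 s * c1 s * G01 + c1 s * c0 s * G01 +
       c1 s * c1 s * G11)
    (2 * (c0' * c0 tau * G00 + c0' * c1 tau * G01 + c1' * c0 tau * G01 +
       c1' * c1 tau * G11)).
Proof.
move=> d0 d1.
have dM (h k : R -> R) (h' k' G : R) : is_derive tau 1 h h' -> is_derive tau 1 k k' ->
    is_derive tau 1 (fun s => h s * k s * G) ((h' * k tau + h tau * k') * G).
  move=> dh dk; apply: (is_derive_eq (is_deriveM (is_deriveM dh dk) (is_derive_cst G tau 1))).
  rewrite scaler0 add0r /GRing.scale /=.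
  by rewrite mulrC addrC [k tau * h']mulrC.
have dD (h k : R -> R) (h' k' : R) : is_derive tau 1 h h' -> is_derive tau 1 k k' ->
    is_derive tau 1 (fun s => h s + k s) (h' + k').
  by move=> dh dk; exact: is_deriveD.
apply: (is_derive_eq (dD _ _ _ _ (dD _ _ _ _ (dD _ _ _ _ (dM _ _ _ _ G00 d0 d0)
  (dM _ _ _ _ G01 d0 d1)) (dM _ _ _ _ G01 d1 d0)) (dM _ _ _ _ G11 d1 d1))).
by move: (c0 tau) (c1 tau) => x y; ring.
Qed.

(** Differentiating in tau the squared norm at time tau^2 gives
    4 tau (gamma_t, gamma), and the perturbation equation turns (gamma_t, gamma)
    into - (dp, gamma). *)
Lemma is_derive_energy_density tau x :
  is_derive tau 1 (energy_density ^~ x) (power_density tau x).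
Proof.
have dx := dom_chart_at A x; set i := chart_at A x in dx.
have G10 : invmx (g i x) 1 0 = invmx (g i x) 0 1.
  by rewrite -[in LHS](gmx_sym g dx) -trmx_inv mxE.
pose c k (s : R) := gam (s ^+ 2) i x 0 k.
pose c' k := form1_t gam (tau ^+ 2) i x 0 k.
have dc k : is_derive tau 1 (c k) (2 * tau * c' k).
  have [[_ sm] _] := gam_harmonic.
  have := smooth_time_sqr_derive (sm i k) tau (cod_chart dx).
  by rewrite /= chartK // /c' [form1_t _ _ _ _ _ _]mxE.
have pE (a b : form1 A) : pairing g a b i x =
    a i x 0 0 * b i x 0 0 * invmx (g i x) 0 0 +
    a i x 0 0 * b i x 0 1 * invmx (g i x) 0 1 +
    a i x 0 1 * b i x 0 0 * invmx (g i x) 0 1 +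
    a i x 0 1 * b i x 0 1 * invmx (g i x) 1 1 by rewrite pairing2E G10.
have := is_derive_quadratic (invmx (g i x) 0 0) (invmx (g i x) 0 1)
  (invmx (g i x) 1 1) (dc 0) (dc 1).
rewrite (_ : (fun s => _) = energy_density ^~ x); last first.
  by apply/funext => s; exact: esym (pE _ _).
congr (is_derive _ _ _ _).
have -> : power_density tau x =
    4 * tau * pairing g (form1_t gam (tau ^+ 2)) (gam (tau ^+ 2)) i x.
  by rewrite pairing_form1_t ?sqr_ge0 // /power_density /pair_d0 /pair -/i; ring.
rewrite pE -/(c' 0) -/(c' 1) -[gam _ _ _ _ 0]/(c 0 tau) -[gam _ _ _ _ 1]/(c 1 tau).
by move: (c' 0) (c' 1) (c 0 tau) (c 1 tau) => *; ring.
Qed.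

Lemma power_density_continuous :
  continuous (fun z : R * M => power_density z.1 z.2).
Proof.
rewrite /power_density /pair_d0 => z; apply: cvgM.
  by apply: cvgM; [exact: cvg_cst|exact: cvg_fst].
apply: (@pair_continuous_param _ _ _ g R (fun tau => d0 (A := A) (p (tau ^+ 2)))
  (fun tau => gam (tau ^+ 2))).
- by move=> tau; apply: d0_covector; apply: p_C1; exact: sqr_ge0.
- by move=> tau; apply: gam_covector; exact: sqr_ge0.
- move=> i k tau u cu.
  have sm := p_smooth (i := i).
  have c := @smooth_time_sqr_partial_continuous _ _ _ (@open_cod _ _ A i) sm tau u k cu.
  apply: near_eq_for_continuous c.
  have nc : \forall w \near (tau, u), cod i w.2 by apply: cvg_snd; exact: near_cod.
  by apply: filterS nc => w cw; rewrite mxE /partial chart_invK.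
- move=> i k tau u cu; have [[_ sm] _] := gam_harmonic.
  exact: (@smooth_time_sqr_continuous _ _ _ (@open_cod _ _ A i) (sm i k) tau u cu).
Qed.

Variable mu : {measure set (g_sigma_algebraType (@open M)) -> \bar R}.
Hypothesis mu_area : is_area_measure g mu.

Definition energy tau := \int[mu]_x energy_density tau x.

(** Differentiation under the integral sign on a segment around tau, where the
    derivative is bounded by compactness; the integral of the derivative vanishes
    by the divergence theorem. *)
Lemma is_derive_energy tau : is_derive tau 1 energy 0.
Proof.
have tau_in : (`]tau - 1, tau + 1[%classic : set R) tau.
  by rewrite /= in_itv /=; apply/andP; split; lra.
have intf s : (`]tau - 1, tau + 1[%classic : set R) s ->
    mu.-integrable [set: g_sigma_algebraType (@open M)] (EFin \o energy_density s).
  move=> _; apply: (continuous_integrableM M_compact M_hausdorff mu_area).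
  have s0 := sqr_ge0 s.
  apply: pair_continuous; [exact: gam_covector|exact: gam_covector|
    exact/C1_form_continuous/gam_C1|exact/C1_form_continuous/gam_C1].
have derf s x : (`]tau - 1, tau + 1[%classic : set R) s -> [set: M] x ->
    derivable (energy_density ^~ x) s 1.
  by move=> _ _; case: (is_derive_energy_density s x).
have [C [_ CP]] : [bounded power_density z.1 z.2 |
    z in `[tau - 1, tau + 1]%classic `*` [set: M]].
  apply: compact_bounded_at; first by apply: compact_setX => //; exact: segment_compact.
  by move=> z _; exact: power_density_continuous.
pose C1 := `|C| + 1.
have C1_ge0 (y : M) : 0 <= (fun=> C1) y by rewrite addr_ge0.
have intC : mu.-integrable [set: g_sigma_algebraType (@open M)] (EFin \o (fun=> C1)).
  apply: (continuous_integrableM M_compact M_hausdorff mu_area) => x.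
  exact: cst_continuous.
have dE s x : partial1of2 energy_density s x = power_density s x.
  by rewrite partial1of2E; case: (is_derive_energy_density s x).
have ub s x : (`]tau - 1, tau + 1[%classic : set R) s -> [set: M] x ->
    `|partial1of2 energy_density s x| <= C1.
  move=> s_in _; rewrite dE; apply: (CP C1 _ (s, x)) => /=.
    by rewrite /C1 ltr_pwDr // ler_norm.
  split=> //=; move: s_in; rewrite /= !in_itv /= => /andP[s1 s2].
  by rewrite !ltW.
have mT : measurable [set: g_sigma_algebraType (@open M)] by exact: measurableT.
apply: DeriveDef.
  exact: (derivable_under_integral mT tau_in intf derf C1_ge0 intC ub).
rewrite -derive1E (differentiation_under_integral mT tau_in intf derf C1_ge0 intC ub).
under eq_Rintegral => x _ do rewrite dE /power_density.
have t0 := sqr_ge0 tau.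
rewrite RintegralZl //; last first.
  apply: (pair_d0_integrable M_compact M_hausdorff mu_area); [exact: gam_covector|exact: gam_C1|exact: p_C1].
rewrite /Rintegral (divergence_theorem M_compact M_hausdorff mu_area) ?mulr0 //.
- exact: gam_covector.
- exact: gam_C1.
- by have [_ /(_ _ t0)[]] := gam_harmonic.
- exact: p_C1.
Qed.

Lemma energy_conserved t : 0 <= t ->
  \int[mu]_x pair g (gam t) (gam t) x = \int[mu]_x pair g (gam 0) (gam 0) x.
Proof.
move=> t0; have := is_derive_0_is_cst (Num.sqrt t) 0 is_derive_energy.
by rewrite /energy /energy_density sqr_sqrtr // expr0n.
Qed.

End energy.

(** When no measure has the area form as density, the default measure is zero and
    both norms vanish. *)
Lemma L2norm_conserved (R : realType) (M : ptopologicalType)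
    (A : oriented_atlas R M) (g : riemannian_metric A)
    (om p : R -> M -> R) (gam : R -> form1 A) (t : R) :
  compact [set: M] -> hausdorff_space M ->
  smooth_harmonic_t g gam -> smooth_function_t A p ->
  perturbation_equation g om gam p -> 0 <= t ->
  L2norm g (gam t) = L2norm g (gam 0).
Proof.
move=> cM hM sg sp eqn t0; rewrite /L2norm /hodge_inner /area_measure.
case: pselect => [h|_]; last by rewrite /Rintegral !integral_measure_zero.
congr Num.sqrt; have area := projT2 (cid h).
exact: (energy_conserved cM hM sg sp eqn area t0).
Qed.

Theorem theorem2 (R : realType) (M : ptopologicalType)
    (M_compact : compact [set: M]) (M_connected : connected [set: M])
    (M_hausdorff : hausdorff_space M)
    (A : oriented_atlas R M) (g : riemannian_metric A)
    (F : R -> vfield A) (psi0 om0 : R -> M -> R) (gam0 : R -> form1 A)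
    (p0 : R -> M -> R)
    (F_smooth : smooth_vector_field_t F)
    (psi0_smooth : smooth_function_t A psi0)
    (om0_smooth : smooth_function_t A om0)
    (gam0_harmonic : smooth_harmonic_t g gam0)
    (p0_smooth : smooth_function_t A p0)
    (euler : euler_hodge_helmholtz g F psi0 om0 gam0 p0) :
  forall eps : R, 0 < eps ->
  exists2 eta : R, 0 < eta &
    forall (gam : R -> form1 A) (p : R -> M -> R),
      smooth_harmonic_t g gam -> smooth_function_t A p ->
      perturbation_equation g om0 gam p ->
      L2norm g (gam 0) < eta ->
      forall t : R, 0 <= t -> L2norm g (gam t) < eps.
Proof.
move=> eps eps0; exists eps => // gam p gam_harm p_smooth eqn small t t0.
by rewrite (L2norm_conserved M_compact M_hausdorff gam_harm p_smooth eqn t0).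
Qed.
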